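(* Let $RL^n=(J^1(\mathbb{R},M),L)$ be a relativistic rheonomic Lagrange space with respect to the semi-Riemannian metric $h=(h_{11})$ on $\mathbb{R}$, with canonical nonlinear connection $\Gamma$ and Cartan canonical connection $C\Gamma$. The electromagnetic local components $F^{(1)}_{(i)j}$ of $RL^n$ are governed by the Maxwell equations $$F^{(1)}_{(i)k/1}=\frac12\mathcal{A}_{\{i,k\}}\left\{\bar D^{(1)}_{(i)1\vert k}+D^{(1)}_{(i)m}T^m_{1k}+d^{(1)(1)}_{(i)(m)}R^{(m)}_{(1)1k}-\left[T^p_{1i\vert k}+C^{p(1)}_{k(m)}R^{(m)}_{(1)1i}\right]y_p\right\},$$ $$\sum_{\{i,j,k\}}F^{(1)}_{(i)j\vert k}=-\frac12\sum_{\{i,j,k\}}C^{(1)(1)(1)}_{(i)(l)(m)}R^{(m)}_{(1)jk}y^l,\qquad\sum_{\{i,j,k\}}F^{(1)}_{(i)j}\vert^{(1)}_{(k)}=0,$$ where $y_p=G^{(1)(1)}_{(p)(q)}y^q$ and $$C^{(1)(1)(1)}_{(i)(l)(m)}=G^{(1)(1)}_{(l)(q)}C^{q(1)}_{i(m)}=\frac{h^{11}}{2}\frac{\partial^3L}{\partial y^i\partial y^l\partial y^m}.$$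
   Context: $M$ is a smooth $n$-dimensional manifold; $E=J^1(\mathbb{R},M)\equiv\mathbb{R}\times TM$ has local coordinates $(t,x^i,y^i)$, latin indices run from $1$ to $n$, the index $1$ refers to the time axis, repeated latin indices are summed. Coordinate changes are $\tilde t=\tilde t(t)$, $\tilde x^i=\tilde x^i(x^j)$, $\tilde y^i=\frac{\partial\tilde x^i}{\partial x^j}\frac{dt}{d\tilde t}y^j$. $h=(h_{11}(t))$ is a semi-Riemannian metric on $\mathbb{R}$, $h^{11}=1/h_{11}$, and $H^1_{11}=\frac{h^{11}}{2}\frac{dh_{11}}{dt}$ is its Christoffel symbol. A smooth $L:E\to\mathbb{R}$ is Kronecker $h$-regular if $G^{(1)(1)}_{(i)(j)}:=\frac12\frac{\partial^2L}{\partial y^i\partial y^j}=h^{11}(t)g_{ij}(t,x^k,y^k)$ with $g_{ij}$ a symmetric d-tensor ($\tilde g_{ij}=\frac{\partial x^k}{\partial\tilde x^i}\frac{\partial x^l}{\partial\tilde x^j}g_{kl}$) of rank $n$ and constant signature; $(g^{ij})=(g_{ij})^{-1}$. Then $RL^n=(E,L)$ is called a relativistic rheonomic Lagrange space. Canonical nonlinear connection $\Gamma$: $M^{(i)}_{(1)1}=-H^1_{11}y^i$, $N^{(i)}_{(1)j}=\partial G^{(i)}_{(1)1}/\partial y^j$ with $$G^{(i)}_{(1)1}=\frac{h_{11}g^{ik}}{4}\left[\frac{\partial^2L}{\partial x^j\partial y^k}y^j-\frac{\partial L}{\partial x^k}+\frac{\partial^2L}{\partial t\partial y^k}+\frac{\partial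 L}{\partial y^k}H^1_{11}+2h^{11}H^1_{11}g_{kl}y^l\right].$$ Adapted basis: $\frac{\delta}{\delta t}=\frac{\partial}{\partial t}-M^{(j)}_{(1)1}\frac{\partial}{\partial y^j}$, $\frac{\delta}{\delta x^i}=\frac{\partial}{\partial x^i}-N^{(j)}_{(1)i}\frac{\partial}{\partial y^j}$, $\frac{\partial}{\partial y^i}$; dual basis $dt$, $dx^i$, $\delta y^i=dy^i+M^{(i)}_{(1)1}dt+N^{(i)}_{(1)j}dx^j$. Cartan canonical connection $C\Gamma=(H^1_{11},G^k_{j1},L^i_{jk},C^{i(1)}_{j(k)})$: $G^k_{j1}=\frac{g^{ki}}2\frac{\delta g_{ij}}{\delta t}$, $L^i_{jk}=\frac{g^{im}}2\left(\frac{\delta g_{jm}}{\delta x^k}+\frac{\delta g_{km}}{\delta x^j}-\frac{\delta g_{jk}}{\delta x^m}\right)$, $C^{i(1)}_{j(k)}=\frac{g^{im}}2\left(\frac{\partial g_{jm}}{\partial y^k}+\frac{\partial g_{km}}{\partial y^j}-\frac{\partial g_{jk}}{\partial y^m}\right)$. It is the linear connection $\nabla$ with $\nabla_{\delta/\delta t}\frac{\delta}{\delta t}=H^1_{11}\frac{\delta}{\delta t}$, $\nabla_{\delta/\delta t}\frac{\delta}{\delta x^i}=G^k_{i1}\frac{\delta}{\delta x^k}$, $\nabla_{\delta/\delta t}\frac{\partial}{\partial y^i}=(G^k_{i1}-\delta^k_iH^1_{11})\frac{\partial}{\partial y^k}$, $\nabla_{\delta/\delta x^j}\frac{\delta}{\delta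 t}=0$, $\nabla_{\delta/\delta x^j}\frac{\delta}{\delta x^i}=L^k_{ij}\frac{\delta}{\delta x^k}$, $\nabla_{\delta/\delta x^j}\frac{\partial}{\partial y^i}=L^k_{ij}\frac{\partial}{\partial y^k}$, $\nabla_{\partial/\partial y^j}\frac{\delta}{\delta t}=0$, $\nabla_{\partial/\partial y^j}\frac{\delta}{\delta x^i}=C^{k(1)}_{i(j)}\frac{\delta}{\delta x^k}$, $\nabla_{\partial/\partial y^j}\frac{\partial}{\partial y^i}=C^{k(1)}_{i(j)}\frac{\partial}{\partial y^k}$. For a d-tensor (a tensor expressed in the adapted basis and its dual), the subscripts $_{/1}$, $_{\vert k}$, $\vert^{(1)}_{(k)}$ denote the components of its covariant derivatives in the directions $\frac{\delta}{\delta t}$, $\frac{\delta}{\delta x^k}$, $\frac{\partial}{\partial y^k}$. An upper index written $(i)$ with lower $(1)$ refers to $\frac{\partial}{\partial y^i}$, a lower index $(i)$ with upper $(1)$ refers to $\delta y^i$; plain indices $i$ refer to $\frac{\delta}{\delta x^i}$ or $dx^i$ and a plain $1$ to $\frac{\delta}{\delta t}$ or $dt$. Torsion components used: $T^m_{1j}=-G^m_{j1}$, $R^{(m)}_{(1)1j}=\frac{\delta M^{(m)}_{(1)1}}{\delta x^j}-\frac{\delta N^{(m)}_{(1)j}}{\delta t}$, $R^{(m)}_{(1)ij}=\frac{\delta N^{(m)}_{(1)i}}{\delta x^j}-\frac{\delta N^{(m)}_{(1)j}}{\delta x^i}$. Deflection d-tensors (covariant derivatives of $y^i\frac{\partial}{\partial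 y^i}$): $\bar D^{(i)}_{(1)1}=y^i_{/1}$, $D^{(i)}_{(1)j}=y^i_{\vert j}$, $d^{(i)(1)}_{(1)(j)}=y^i\vert^{(1)}_{(j)}$. Metrical deflection d-tensors: $\bar D^{(1)}_{(i)1}=G^{(1)(1)}_{(i)(k)}\bar D^{(k)}_{(1)1}$, $D^{(1)}_{(i)j}=G^{(1)(1)}_{(i)(k)}D^{(k)}_{(1)j}$, $d^{(1)(1)}_{(i)(j)}=G^{(1)(1)}_{(i)(k)}d^{(k)(1)}_{(1)(j)}$. Electromagnetic components: $F^{(1)}_{(i)j}=\frac12\left[D^{(1)}_{(i)j}-D^{(1)}_{(j)i}\right]$. $\mathcal{A}_{\{i,k\}}$ means alternate sum ($\mathcal{A}_{\{i,k\}}X_{ik}=X_{ik}-X_{ki}$) and $\sum_{\{i,j,k\}}$ means cyclic sum.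
   Formalization: Two printed constants are corrected: the second Maxwell equation has coefficient -1 instead of -1/2, and the lowered C equals (1/4) times the third y-derivative of L instead of h^11/2 times it; the printed chain fails for n=1, h_11=1, L=y^2+y^4. *)

(* Defs.v *)
(* MathComp-Analysis; the real numbers are an arbitrary R : realType. *)
From HB Require Import structures.
From mathcomp Require Import all_boot all_order all_algebra.
From mathcomp Require Import all_classical all_reals all_analysis.
Set Implicit Arguments.
Unset Strict Implicit.
Unset Printing Implicit Defensive.
Import Order.TTheory GRing.Theory Num.Theory.
Import numFieldNormedType.Exports.
Local Open Scope classical_set_scope.
Local Open Scope ring_scope.

Definition iter_derive (R : realType) (V W : normedModType R)
    (f : V -> W) (vs : seq V) : V -> W :=
  foldr (fun v g => 'D_v g) f vs.

(* C^oo on an open set D of a finite-dimensional space: all iterated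
   directional derivatives exist and are continuous. *)
Definition smooth_on (R : realType) (V W : normedModType R)
    (D : set V) (f : V -> W) : Prop :=
  forall (vs : seq V) (p : V), D p ->
    {for p, continuous (iter_derive f vs)} /\
    (forall v, derivable (iter_derive f vs) p v).

(** * Smooth manifolds *)

(* Only the restrictions of coord to dom and of icoord to coord @` dom
   are meaningful. *)
Record chart (T V : topologicalType) := Chart {
  dom : set T;
  coord : T -> V;
  icoord : V -> T }.

Definition range_of (T V : topologicalType) (a : chart T V) : set V :=
  coord a @` dom a.

Definition is_chart (T V : topologicalType) (a : chart T V) : Prop :=
  [/\ open (dom a), open (range_of a),
      (forall m, dom a m -> icoord a (coord a m) = m),
      (forall m, dom a m -> {for m, continuous (coord a)}) &
      (forall x, range_of a x -> {for x, continuous (icoord a)})].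

Definition overlap (T V : topologicalType) (b a : chart T V) : set V :=
  coord b @` (dom a `&` dom b).

(* the coordinates of a as functions of those of b, defined on overlap b a *)
Definition change (T V : topologicalType) (b a : chart T V) : V -> V :=
  coord a \o icoord b.

Definition smooth_manifold (R : realType) (n : nat) (M : topologicalType)
    (atlas : set (chart M 'rV[R]_n)) : Prop :=
  [/\ hausdorff_space M, @second_countable M,
      (forall a, atlas a -> is_chart a),
      (forall m, exists2 a, atlas a & dom a m) &
      (forall a b, atlas a -> atlas b ->
         smooth_on (overlap b a) (change b a))].

(* local coordinates on the manifold R: the maximal atlas of the identity *)
Definition time_chart (R : realType) (a : chart R R) : Prop :=
  [/\ is_chart a, smooth_on (dom a) (coord a : R -> R) &
      smooth_on (range_of a) (icoord a : R -> R)].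

(* h a is the component h_11 of the metric in the time coordinate a *)
Definition semi_Riemannian_metric (R : realType)
    (h : chart R R -> R -> R) : Prop :=
  (forall a, time_chart a ->
     smooth_on (range_of a) (h a) /\
     (forall t, range_of a t -> h a t != 0)) /\
  (forall a b, time_chart a -> time_chart b ->
     forall t, overlap b a t ->
       h b t = h a (change b a t) * (derive1 (change b a) t) ^+ 2).

(** * The jet space J^1(R, M) *)

(* local coordinates (t, x, y) of a point of J^1(R, M) *)
Definition jet (R : realType) (n : nat) : normedModType R :=
  (R * 'rV[R]_n * 'rV[R]_n)%type.

Definition tc (R : realType) (n : nat) (p : jet R n) : R := p.1.1.
Definition xc (R : realType) (n : nat) (p : jet R n) : 'rV[R]_n := p.1.2.
Definition yc (R : realType) (n : nat) (i : 'I_n) (p : jet R n) : R :=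
  p.2 0 i.

Definition jet_range (R : realType) (n : nat) (M : topologicalType)
    (s : chart R R) (a : chart M 'rV[R]_n) : set (jet R n) :=
  [set p | range_of s (tc p) /\ range_of a (xc p)].

Definition jet_overlap (R : realType) (n : nat) (M : topologicalType)
    (s' : chart R R) (b : chart M 'rV[R]_n)
    (s : chart R R) (a : chart M 'rV[R]_n) : set (jet R n) :=
  [set p | overlap s' s (tc p) /\ overlap b a (xc p)].

(* partial x_a^j / partial x_b^i at the point of b-coordinates x *)
Definition jac (R : realType) (n : nat) (M : topologicalType)
    (b a : chart M 'rV[R]_n) (j i : 'I_n) (x : 'rV[R]_n) : R :=
  ('D_(delta_mx 0 i) (change b a) x) 0 j.

(* From the coordinates (t', x', y') of (s', b) to the coordinates (t, x, y) of
   (s, a): t = t(t'), x = x(x'), y^i = (dx^i/dx'^j) (dt'/dt) y'^j. *)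
Definition jet_change (R : realType) (n : nat) (M : topologicalType)
    (s' : chart R R) (b : chart M 'rV[R]_n)
    (s : chart R R) (a : chart M 'rV[R]_n) (p : jet R n) : jet R n :=
  (change s' s (tc p),
   change b a (xc p),
   \row_i \sum_(j < n) jac b a i j (xc p)
          * derive1 (change s s') (change s' s (tc p)) * yc j p).

(* A function on J^1(R, M), a d-tensor, ... is given by its components in all
   the local coordinates (s, a). *)
Definition on_jet (R : realType) (n : nat) (M : topologicalType) (X : Type) :=
  chart R R -> chart M 'rV[R]_n -> jet R n -> X.

Definition smooth_function (R : realType) (n : nat) (M : topologicalType)
    (atlas : set (chart M 'rV[R]_n)) (L : on_jet R n M R) : Prop :=
  (forall s a, time_chart s -> atlas a ->
     smooth_on (jet_range s a) (L s a)) /\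
  (forall s s' a b, time_chart s -> time_chart s' -> atlas a -> atlas b ->
     forall p, jet_overlap s' b s a p ->
       L s' b p = L s a (jet_change s' b s a p)).

Definition symmetric_d_tensor (R : realType) (n : nat) (M : topologicalType)
    (atlas : set (chart M 'rV[R]_n)) (g : on_jet R n M 'M[R]_n) : Prop :=
  (forall s a, time_chart s -> atlas a ->
     forall p, jet_range s a p -> (g s a p)^T = g s a p) /\
  (forall s s' a b, time_chart s -> time_chart s' -> atlas a -> atlas b ->
     forall p, jet_overlap s' b s a p -> forall i j,
       g s' b p i j = \sum_(k < n) \sum_(l < n)
         jac b a k i (xc p) * jac b a l j (xc p)
         * g s a (jet_change s' b s a p) k l).

(* Signature (r, n - r) of a nondegenerate symmetric matrix. *)
Definition has_signature (R : realType) (n : nat) (r : nat)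
    (A : 'M[R]_n) : Prop :=
  exists2 P : 'M[R]_n, P \in unitmx &
    P *m A *m P^T = diag_mx (\row_(j < n) (if (j < r)%N then 1 else -1)).

Definition dt_ (R : realType) (n : nat) (f : jet R n -> R) (p : jet R n) : R :=
  'D_((1, 0, 0) : jet R n) f p.

Definition dx_ (R : realType) (n : nat) (i : 'I_n) (f : jet R n -> R)
    (p : jet R n) : R :=
  'D_((0, delta_mx 0 i, 0) : jet R n) f p.

Definition dy_ (R : realType) (n : nat) (i : 'I_n) (f : jet R n -> R)
    (p : jet R n) : R :=
  'D_((0, 0, delta_mx 0 i) : jet R n) f p.

(* G^(1)(1)_(i)(j) *)
Definition vertical_metric (R : realType) (n : nat) (L : jet R n -> R)
    (i j : 'I_n) (p : jet R n) : R :=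
  2^-1 * dy_ i (dy_ j L) p.

Definition Kronecker_regular (R : realType) (n : nat) (M : topologicalType)
    (atlas : set (chart M 'rV[R]_n)) (h : chart R R -> R -> R)
    (L : on_jet R n M R) (g : on_jet R n M 'M[R]_n) : Prop :=
  [/\ (forall s a, time_chart s -> atlas a ->
         forall p, jet_range s a p -> forall i j,
           vertical_metric (L s a) i j p = (h s (tc p))^-1 * g s a p i j),
      symmetric_d_tensor atlas g,
      (forall s a, time_chart s -> atlas a ->
         forall p, jet_range s a p -> \rank (g s a p) = n) &
      (exists r : nat, forall s a, time_chart s -> atlas a ->
         forall p, jet_range s a p -> has_signature r (g s a p))].

Definition rheonomic_Lagrange_space (R : realType) (n : nat)
    (M : topologicalType) (atlas : set (chart M 'rV[R]_n))
    (h : chart R R -> R -> R) (L : on_jet R n M R) (g : on_jet R n M 'M[R]_n) :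
    Prop :=
  smooth_function atlas L /\ Kronecker_regular atlas h L g.

(** * Geometry of a rheonomic Lagrange space in local coordinates *)

Record local_data (R : realType) (n : nat) := LocalData {
  h11 : R -> R;
  Lag : jet R n -> R;
  gdn : jet R n -> 'M[R]_n }.

Definition local_expression (R : realType) (n : nat) (M : topologicalType)
    (h : chart R R -> R -> R) (L : on_jet R n M R) (g : on_jet R n M 'M[R]_n)
    (s : chart R R) (a : chart M 'rV[R]_n) : local_data R n :=
  LocalData (h s) (L s a) (g s a).

Definition hup (R : realType) (n : nat) (S : local_data R n) (p : jet R n) : R :=
  (h11 S (tc p))^-1.

Definition gup (R : realType) (n : nat) (S : local_data R n) (p : jet R n) :
    'M[R]_n :=
  invmx (gdn S p).

(* H^1_11 *)
Definition H1 (R : realType) (n : nat) (S : local_data R n) (p : jet R n) : R :=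
  hup S p / 2 * derive1 (h11 S) (tc p).

Definition Gv (R : realType) (n : nat) (S : local_data R n) :=
  vertical_metric (Lag S).

(* G^(i)_(1)1 *)
Definition spray (R : realType) (n : nat) (S : local_data R n) (i : 'I_n)
    (p : jet R n) : R :=
  \sum_(k < n) h11 S (tc p) * gup S p i k / 4 *
    (\sum_(j < n) dx_ j (dy_ k (Lag S)) p * yc j p
     - dx_ k (Lag S) p
     + dt_ (dy_ k (Lag S)) p
     + dy_ k (Lag S) p * H1 S p
     + \sum_(l < n) 2 * hup S p * H1 S p * gdn S p k l * yc l p).

(* M^(i)_(1)1 and N^(i)_(1)j *)
Definition Mc (R : realType) (n : nat) (S : local_data R n) (i : 'I_n)
    (p : jet R n) : R :=
  - H1 S p * yc i p.

Definition Nc (R : realType) (n : nat) (S : local_data R n) (i j : 'I_n)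
    (p : jet R n) : R :=
  dy_ j (spray S i) p.

(* Labels of the adapted basis d/dt, d/dx^i, d/dy^i and of its dual basis. *)
Inductive aidx (n : nat) := At | Ax of 'I_n | Ay of 'I_n.
Arguments At {n}.

Definition asum (R : realType) (n : nat) (F : aidx n -> R) : R :=
  F At + \sum_(i < n) F (Ax i) + \sum_(i < n) F (Ay i).

Definition adapted (R : realType) (n : nat) (S : local_data R n) (a : aidx n)
    (f : jet R n -> R) (p : jet R n) : R :=
  match a with
  | At => dt_ f p - \sum_(j < n) Mc S j p * dy_ j f p
  | Ax i => dx_ i f p - \sum_(j < n) Nc S j i p * dy_ j f p
  | Ay i => dy_ i f p
  end.

Definition gij (R : realType) (n : nat) (S : local_data R n) (i j : 'I_n)
    (p : jet R n) : R :=
  gdn S p i j.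

(* G^k_j1 *)
Definition Gc (R : realType) (n : nat) (S : local_data R n) (k j : 'I_n)
    (p : jet R n) : R :=
  \sum_(i < n) gup S p k i / 2 * adapted S At (gij S i j) p.

(* L^i_jk *)
Definition Lc (R : realType) (n : nat) (S : local_data R n) (i j k : 'I_n)
    (p : jet R n) : R :=
  \sum_(m < n) gup S p i m / 2 *
    (adapted S (Ax k) (gij S j m) p + adapted S (Ax j) (gij S k m) p
     - adapted S (Ax m) (gij S j k) p).

(* C^i(1)_j(k) *)
Definition Cc (R : realType) (n : nat) (S : local_data R n) (i j k : 'I_n)
    (p : jet R n) : R :=
  \sum_(m < n) gup S p i m / 2 *
    (dy_ k (gij S j m) p + dy_ j (gij S k m) p - dy_ m (gij S j k) p).

(* Cartan canonical connection: nabla_{e_a} e_b = sum_c (Cartan a b c) e_c. *)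
Definition Cartan (R : realType) (n : nat) (S : local_data R n)
    (a b c : aidx n) (p : jet R n) : R :=
  match a, b, c with
  | At, At, At => H1 S p
  | At, Ax i, Ax k => Gc S k i p
  | At, Ay i, Ay k => Gc S k i p - (k == i)%:R * H1 S p
  | Ax j, Ax i, Ax k => Lc S k i j p
  | Ax j, Ay i, Ay k => Lc S k i j p
  | Ay j, Ax i, Ax k => Cc S k i j p
  | Ay j, Ay i, Ay k => Cc S k i j p
  | _, _, _ => 0
  end.

(* Components in the adapted bases of the covariant derivative along e_a of
   X^c e_c, of W_bc e^b (x) e^c and of T^d_bc e_d (x) e^b (x) e^c. *)
Definition nabla10 (R : realType) (n : nat) (S : local_data R n) (a : aidx n)
    (X : aidx n -> jet R n -> R) (c : aidx n) (p : jet R n) : R :=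
  adapted S a (X c) p + asum (fun e => Cartan S a e c p * X e p).

Definition nabla02 (R : realType) (n : nat) (S : local_data R n) (a : aidx n)
    (W : aidx n -> aidx n -> jet R n -> R) (b c : aidx n) (p : jet R n) : R :=
  adapted S a (W b c) p
  - asum (fun e => Cartan S a b e p * W e c p)
  - asum (fun e => Cartan S a c e p * W b e p).

Definition nabla12 (R : realType) (n : nat) (S : local_data R n) (a : aidx n)
    (T : aidx n -> aidx n -> aidx n -> jet R n -> R) (d b c : aidx n)
    (p : jet R n) : R :=
  adapted S a (T d b c) p
  + asum (fun e => Cartan S a e d p * T e b c p)
  - asum (fun e => Cartan S a b e p * T d e c p)
  - asum (fun e => Cartan S a c e p * T d b e p).

(* T^m_1j, R^(m)_(1)1j and R^(m)_(1)ij *)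
Definition Ttor (R : realType) (n : nat) (S : local_data R n) (m j : 'I_n)
    (p : jet R n) : R :=
  - Gc S m j p.

Definition Rt (R : realType) (n : nat) (S : local_data R n) (m j : 'I_n)
    (p : jet R n) : R :=
  adapted S (Ax j) (Mc S m) p - adapted S At (Nc S m j) p.

Definition Rx (R : realType) (n : nat) (S : local_data R n) (m i j : 'I_n)
    (p : jet R n) : R :=
  adapted S (Ax j) (Nc S m i) p - adapted S (Ax i) (Nc S m j) p.

(* y^i d/dy^i *)
Definition Liouville (R : realType) (n : nat) (c : aidx n) (p : jet R n) : R :=
  if c is Ay i then yc i p else 0.

(* Deflection d-tensors; the suffix _l marks the metrical ones. *)
Definition defl_t (R : realType) (n : nat) (S : local_data R n) (i : 'I_n) :=
  nabla10 S At (@Liouville R n) (Ay i).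
Definition defl_x (R : realType) (n : nat) (S : local_data R n) (i j : 'I_n) :=
  nabla10 S (Ax j) (@Liouville R n) (Ay i).
Definition defl_y (R : realType) (n : nat) (S : local_data R n) (i j : 'I_n) :=
  nabla10 S (Ay j) (@Liouville R n) (Ay i).

Definition defl_t_l (R : realType) (n : nat) (S : local_data R n) (i : 'I_n)
    (p : jet R n) : R :=
  \sum_(k < n) Gv S i k p * defl_t S k p.
Definition defl_x_l (R : realType) (n : nat) (S : local_data R n) (i j : 'I_n)
    (p : jet R n) : R :=
  \sum_(k < n) Gv S i k p * defl_x S k j p.
Definition defl_y_l (R : realType) (n : nat) (S : local_data R n) (i j : 'I_n)
    (p : jet R n) : R :=
  \sum_(k < n) Gv S i k p * defl_y S k j p.

(* F^(1)_(i)j *)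
Definition Fem (R : realType) (n : nat) (S : local_data R n) (i j : 'I_n)
    (p : jet R n) : R :=
  2^-1 * (defl_x_l S i j p - defl_x_l S j i p).

(* y_p *)
Definition ylow (R : realType) (n : nat) (S : local_data R n) (i : 'I_n)
    (p : jet R n) : R :=
  \sum_(q < n) Gv S i q p * yc q p.

(* C^(1)(1)(1)_(i)(l)(m), the index q of C^q(1)_i(m) being lowered with
   G^(1)(1)_(l)(q) = (1/2) d^2L/dy^l dy^q. *)
Definition Clow (R : realType) (n : nat) (S : local_data R n) (i l m : 'I_n)
    (p : jet R n) : R :=
  \sum_(q < n) Gv S l q p * Cc S q i m p.

(* The d-tensors F^(1)_(i)j dy^i (x) dx^j, Dbar^(1)_(i)1 dy^i (x) dt and
   T^m_1j d/dx^m (x) dt (x) dx^j (adapted bases), with all their components. *)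
Definition Fem_tensor (R : realType) (n : nat) (S : local_data R n)
    (b c : aidx n) (p : jet R n) : R :=
  match b, c with Ay i, Ax j => Fem S i j p | _, _ => 0 end.

Definition defl_t_tensor (R : realType) (n : nat) (S : local_data R n)
    (b c : aidx n) (p : jet R n) : R :=
  match b, c with Ay i, At => defl_t_l S i p | _, _ => 0 end.

Definition Ttor_tensor (R : realType) (n : nat) (S : local_data R n)
    (d b c : aidx n) (p : jet R n) : R :=
  match d, b, c with Ax m, At, Ax j => Ttor S m j p | _, _, _ => 0 end.

(* F^(1)_(i)k/1, F^(1)_(i)j|k (horizontal and vertical), Dbar^(1)_(i)1|k and
   T^m_1i|k *)
Definition Fem_t (R : realType) (n : nat) (S : local_data R n) (i k : 'I_n) :=
  nabla02 S At (Fem_tensor S) (Ay i) (Ax k).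
Definition Fem_x (R : realType) (n : nat) (S : local_data R n) (i j k : 'I_n) :=
  nabla02 S (Ax k) (Fem_tensor S) (Ay i) (Ax j).
Definition Fem_y (R : realType) (n : nat) (S : local_data R n) (i j k : 'I_n) :=
  nabla02 S (Ay k) (Fem_tensor S) (Ay i) (Ax j).
Definition defl_t_l_x (R : realType) (n : nat) (S : local_data R n)
    (i k : 'I_n) :=
  nabla02 S (Ax k) (defl_t_tensor S) (Ay i) At.
Definition Ttor_x (R : realType) (n : nat) (S : local_data R n)
    (m i k : 'I_n) :=
  nabla12 S (Ax k) (Ttor_tensor S) (Ax m) At (Ax i).

Definition alternate (R : realType) (n : nat) (X : 'I_n -> 'I_n -> R)
    (i k : 'I_n) : R :=
  X i k - X k i.

Definition cyclic_sum (R : realType) (n : nat)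
    (X : 'I_n -> 'I_n -> 'I_n -> R) (i j k : 'I_n) : R :=
  X i j k + X j k i + X k i j.

(* Main.v *)
(* Write y_i = G_ij y^j, and X_t, X_k for the derivations d/dt, d/dx^k of the
   adapted basis.  Since the Cartan connection is metrical, the horizontal
   covariant derivative of the covector y_i is D_ik, and L^i_jk is symmetric in
   j and k, so F_ij = (X_j y_i - X_i y_j) / 2.  The alternate or cyclic sums in
   the Maxwell equations therefore involve only commutators of the adapted
   derivations, whose vertical parts are the torsions R.  The cyclic horizontal
   equation needs moreover that the cyclic sum of G_im R^m_jk vanishes: this
   comes from X_j (dL/dy^i) = X_i (dL/dy^j), which is what the canonical
   nonlinear connection achieves. *)

(* Indices are lowered with G_ij = h^11 g_ij, not with g_ij: G is half the vertical Hessian of L, so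
   dG_ij/dy^m is totally symmetric, and X_k and Y_k = d/dy^k do not see h^11, a function of t alone.
   Time is the exception: X_t h^11 = - 2 H h^11, and this together with X_t y^i = H y^i produces the
   H terms of the first equation, which cancel in the end. The constants: C_ilm = (1/2) dG_il/dy^m =
   (1/4) d^3L/dy^i dy^l dy^m, the factor h^11 being already inside G. Hence Y_m y_i = G_im + 2 C_ilm
   y^l, and the 1/2 in F absorbs this 2, so that C R y enters the cyclic horizontal equation with
   coefficient -1. The obstacle is locality: functions are total, but smoothness and identities hold
   on an open coordinate domain D only. The operators are therefore treated as abstract derivations
   that see values on D alone; coordinates come back to verify the structure equations. *)
Require Import Defs.
From mathcomp Require Import all_boot all_order all_algebra.
From mathcomp Require Import all_classical all_reals all_analysis.
From mathcomp Require Import ring lra.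
Import Order.TTheory GRing.Theory Num.Theory.
Import numFieldNormedType.Exports.
Local Open Scope classical_set_scope.
Local Open Scope ring_scope.

Set Implicit Arguments.
Unset Strict Implicit.
Unset Printing Implicit Defensive.

(** * Smooth functions on an open set *)

Section SmoothFunctions.
Variables (R : realType) (V : normedModType R) (D : set V).
Hypothesis openD : open D.
Implicit Types (f g : V -> R) (p v : V).

(** Recursion on the order, without lists of directions, lets products and inverses be handled by
    induction on k. *)
Fixpoint Ck (k : nat) f : Prop :=
  (forall p, D p -> {for p, continuous f}) /\
  if k is k'.+1 then
    (forall p v, D p -> derivable f p v) /\ (forall v, Ck k' ('D_v f))
  else True.

Definition smooth f := forall k, Ck k f.

Lemma near_D p : D p -> \forall q \near p, D q.
Proof. by move=> Dp; apply: open_nbhs_nbhs. Qed.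

Lemma near_eqD f g p : D p -> (forall q, D q -> f q = g q) ->
  \forall q \near p, f q = g q.
Proof. by move=> Dp fg; apply: filterS (near_D Dp) => q /fg. Qed.

Lemma derive_ext f g v p : D p -> (forall q, D q -> f q = g q) ->
  'D_v f p = 'D_v g p.
Proof. by move=> Dp fg; apply: near_eq_derive; exact: near_eqD. Qed.

Lemma Ck_continuous k f : Ck k f -> forall p, D p -> {for p, continuous f}.
Proof. by case: k => [|k] []. Qed.

Lemma Ck_ext k f g : (forall p, D p -> f p = g p) -> Ck k f -> Ck k g.
Proof.
elim: k f g => [|k IHk] f g fg [cf kf]; split.
- move=> p Dp; rewrite /prop_for /continuous_at -(fg _ Dp).
  by apply: cvg_trans (cf p Dp); apply: near_eq_cvg; exact: near_eqD.
- by [].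
- move=> p Dp; rewrite /prop_for /continuous_at -(fg _ Dp).
  by apply: cvg_trans (cf p Dp); apply: near_eq_cvg; exact: near_eqD.
- case: kf => df kf; split.
    by move=> p v Dp; apply: near_eq_derivable (df p v Dp); exact: near_eqD.
  by move=> v; apply: IHk (kf v) => p Dp; exact: derive_ext.
Qed.

Lemma Ck_le k f : Ck k.+1 f -> Ck k f.
Proof.
elim: k f => [|k IHk] f [cf [df kf]]; first by split.
by split=> //; split=> // v; exact/IHk/kf.
Qed.

Lemma Ck_cst k (c : R) : Ck k (fun=> c).
Proof.
elim: k c => [|k IHk] c; split=> //; first by move=> p _; exact: cst_continuous.
  by move=> p _; exact: cst_continuous.
split=> [p v _|v]; first exact: derivable_cst.
by apply: Ck_ext (IHk 0) => p _; rewrite derive_cst.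
Qed.

Lemma CkD k f g : Ck k f -> Ck k g -> Ck k (fun p => f p + g p).
Proof.
elim: k f g => [|k IHk] f g [cf kf] [cg kg]; split=> //.
- by move=> p Dp; apply: continuousD; [exact: cf|exact: cg].
- by move=> p Dp; apply: continuousD; [exact: cf|exact: cg].
case: kf kg => df kf [dg kg]; split=> [p v Dp|v].
  by apply: derivableD; [exact: df|exact: dg].
apply: Ck_ext (IHk _ _ (kf v) (kg v)) => p Dp.
by rewrite -deriveD//; [exact: df|exact: dg].
Qed.

Lemma CkM k f g : Ck k f -> Ck k g -> Ck k (fun p => f p * g p).
Proof.
elim: k f g => [|k IHk] f g Cf Cg;
  have [cf kf] := Cf; have [cg kg] := Cg; split=> //.
- by move=> p Dp; apply: continuousM; [exact: cf|exact: cg].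
- by move=> p Dp; apply: continuousM; [exact: cf|exact: cg].
case: kf kg => df kf [dg kg]; split=> [p v Dp|v].
  by apply: derivableM; [exact: df|exact: dg].
(* Each Leibniz term pairs a derivative, known to order k only, with an undifferentiated factor,
   which is brought down to order k. *)
have C1 := IHk _ _ (Ck_le Cf) (kg v); have C2 := IHk _ _ (Ck_le Cg) (kf v).
apply: Ck_ext (CkD C1 C2) => p Dp.
by rewrite deriveM//; [exact: df|exact: dg].
Qed.

Lemma CkV k f : (forall p, D p -> f p != 0) -> Ck k f ->
  Ck k (fun p => (f p)^-1).
Proof.
move=> f0; elim: k => [|k IHk] Cf; have [cf kf] := Cf; split=> //.
- by move=> p Dp; apply: continuousV; [exact: f0|exact: cf].
- by move=> p Dp; apply: continuousV; [exact: f0|exact: cf].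
case: kf => df kf; split=> [p v Dp|v].
  by apply: derivableV; [exact: f0|exact: df].
have CV := IHk (Ck_le Cf).
apply: Ck_ext (CkM (CkM (Ck_cst k (-1)) (CkM CV CV)) (kf v)) => p Dp.
rewrite deriveV; [|exact: f0|exact: df].
by rewrite expr2 invfM mulN1r.
Qed.

Lemma smooth_cst (c : R) : smooth (fun=> c).
Proof. by move=> k; exact: Ck_cst. Qed.

Lemma smooth_ext f g : (forall p, D p -> f p = g p) -> smooth f -> smooth g.
Proof. by move=> fg sf k; apply: Ck_ext (sf k). Qed.

Lemma smoothD f g : smooth f -> smooth g -> smooth (fun p => f p + g p).
Proof. by move=> sf sg k; exact: CkD. Qed.

Lemma smoothM f g : smooth f -> smooth g -> smooth (fun p => f p * g p).
Proof. by move=> sf sg k; exact: CkM. Qed.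

Lemma smoothV f : (forall p, D p -> f p != 0) -> smooth f ->
  smooth (fun p => (f p)^-1).
Proof. by move=> f0 sf k; exact: CkV. Qed.

Lemma smoothN f : smooth f -> smooth (fun p => - f p).
Proof.
move=> sf; apply: smooth_ext (smoothM (smooth_cst (-1)) sf) => p _.
by rewrite mulN1r.
Qed.

Lemma smoothB f g : smooth f -> smooth g -> smooth (fun p => f p - g p).
Proof. by move=> sf sg; apply: smoothD => //; exact: smoothN. Qed.

Lemma smooth_sum (I : Type) (r : seq I) (P : pred I) (F : I -> V -> R) :
  (forall i, P i -> smooth (F i)) ->
  smooth (fun p => \sum_(i <- r | P i) F i p).
Proof.
move=> sF; elim: r => [|i r IHr].
  by apply: smooth_ext (smooth_cst 0) => p _; rewrite big_nil.
case Pi: (P i); last by apply: smooth_ext IHr => p _; rewrite big_cons Pi.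
by apply: smooth_ext (smoothD (sF i Pi) IHr) => p _; rewrite big_cons Pi.
Qed.

Lemma smooth_prod (I : Type) (r : seq I) (P : pred I) (F : I -> V -> R) :
  (forall i, P i -> smooth (F i)) ->
  smooth (fun p => \prod_(i <- r | P i) F i p).
Proof.
move=> sF; elim: r => [|i r IHr].
  by apply: smooth_ext (smooth_cst 1) => p _; rewrite big_nil.
case Pi: (P i); last by apply: smooth_ext IHr => p _; rewrite big_cons Pi.
by apply: smooth_ext (smoothM (sF i Pi) IHr) => p _; rewrite big_cons Pi.
Qed.

Lemma smooth_continuous f p : smooth f -> D p -> {for p, continuous f}.
Proof. by move=> sf Dp; exact: Ck_continuous (sf 0%N) p Dp. Qed.

Lemma smooth_derivable f p v : smooth f -> D p -> derivable f p v.
Proof. by move=> sf Dp; have [_ [df _]] := sf 1%N; exact: df. Qed.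

Lemma smooth_derive f v : smooth f -> smooth ('D_v f).
Proof. by move=> sf k; have [_ [_ kf]] := sf k.+1; exact: kf. Qed.

Lemma smooth_on_smooth f : smooth_on D f -> smooth f.
Proof.
move=> sf k; elim: k f sf => [|k IHk] f sf; split=> //.
- by move=> p Dp; have [] := sf [::] p Dp.
- by move=> p Dp; have [] := sf [::] p Dp.
split=> [p v Dp|v]; first by have [_] := sf [::] p Dp.
apply: IHk => vs p Dp.
(* [Ck] differentiates along v first, and the innermost direction of [iter_derive] is the last of
   the list. *)
by have := sf (rcons vs v) p Dp; rewrite /iter_derive foldr_rcons.
Qed.

Lemma smooth_det (m : nat) (A : V -> 'M[R]_m) :
  (forall i j, smooth (fun p => A p i j)) -> smooth (fun p => \det (A p)).
Proof.
move=> sA; apply: smooth_sum => s _; apply: smoothM; first exact: smooth_cst.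
exact: smooth_prod.
Qed.

(** Cramer's rule: cofactors are polynomial in the entries, and the determinant does not vanish on
    D. *)
Lemma smooth_invmx (m : nat) (A : V -> 'M[R]_m) :
  (forall p, D p -> A p \in unitmx) ->
  (forall i j, smooth (fun p => A p i j)) ->
  forall i j, smooth (fun p => invmx (A p) i j).
Proof.
move=> uA sA i j.
apply: (@smooth_ext (fun p => (\det (A p))^-1 * cofactor (A p) j i)).
  by move=> p /uA uAp; rewrite /invmx uAp !mxE.
apply: smoothM; last first.
  rewrite /cofactor; apply: smoothM; first exact: smooth_cst.
  apply: smooth_det => k l; apply: smooth_ext (sA (lift j k) (lift i l)) => p _.
  by rewrite !mxE.
apply: smoothV (smooth_det sA) => p /uA.
by rewrite unitmxE unitfE.
Qed.

Lemma is_derive_line f q u (s : R) : derivable f (q + s *: u) u ->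
  is_derive s 1 (fun s : R => f (q + s *: u)) ('D_u f (q + s *: u)).
Proof.
move=> df.
pose g (s : R) := f (q + s *: u).
have E : (fun h : R => h^-1 *: ((g \o shift s) (h *: 1) - g s)) =
    (fun h : R => h^-1 *: ((f \o shift (q + s *: u)) (h *: u) - g s)).
  apply/funext => h /=; rewrite /g; congr (_ *: (f _ - _)).
  by rewrite [h *: 1]mulr1 scalerDl addrCA.
by split; rewrite /derivable /derive -/g E.
Qed.

(* The mean value theorem, once in each direction, writes the second difference
   of f over a small parallelogram as a value of D_v D_u f. *)
Lemma second_difference f u v p (r : R) : smooth f -> 0 < r ->
  (forall s t : R, 0 <= s <= r -> 0 <= t <= r -> D (p + s *: u + t *: v)) ->
  exists s, exists t, [/\ 0 <= s <= r, 0 <= t <= r &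
    f (p + r *: u + r *: v) - (f (p + r *: u) + f (p + r *: v)) + f p =
    'D_v ('D_u f) (p + s *: u + t *: v) * r ^+ 2].
Proof.
move=> sf r0 Dr; have r0' := ltW r0.
have mvt (F dF : R -> R) : (forall x, 0 <= x <= r -> is_derive x 1 F (dF x)) ->
    exists2 c, 0 <= c <= r & F r - F 0 = dF c * r.
  move=> FdF; have [x xr| |c] := @MVT_segment _ F dF 0 r r0'.
  - by apply: FdF; move: xr; rewrite in_itv /= => /andP[/ltW -> /ltW ->].
  - apply: continuous_in_subspaceT => x; rewrite inE/= in_itv /= => xr.
    apply/differentiable_continuous/derivable1_diffP.
    exact: (@ex_derive _ _ _ _ _ _ _ (FdF x xr)).
  - by rewrite in_itv /= subr0 => cr FE; exists c.
have [|s sr Es] := mvt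
  (fun s => f (p + r *: v + s *: u) - f (p + s *: u))
  (fun s => 'D_u f (p + r *: v + s *: u) - 'D_u f (p + s *: u)).
  move=> x xr; apply: is_deriveB; apply: is_derive_line;
    apply: smooth_derivable => //.
  - by rewrite addrAC; apply: Dr => //; rewrite r0' lexx.
  - by have := Dr x 0 xr; rewrite scale0r addr0; apply; rewrite lexx.
have [|t tr Et] := mvt
  (fun t => 'D_u f (p + s *: u + t *: v))
  (fun t => 'D_v ('D_u f) (p + s *: u + t *: v)).
  move=> x xr; apply: is_derive_line; apply: smooth_derivable; last exact: Dr.
  exact: smooth_derive.
exists s, t; split=> //.
rewrite expr2 mulrA -Et scale0r addr0.
have -> : p + s *: u + r *: v = p + r *: v + s *: u by rewrite addrAC.
rewrite -Es !scale0r !addr0 (addrAC p (r *: v)).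
ring.
Qed.

End SmoothFunctions.

(** * Symmetry of second derivatives *)

Section Schwarz.
Variables (R : realType) (V : normedModType R) (D : set V).
Hypothesis openD : open D.

(* D_v D_u f (p) and D_u D_v f (p) are both limits of the symmetric second
   difference of f divided by r^2. *)
Lemma derive_comm (f : V -> R) (u v p : V) : smooth D f -> D p ->
  'D_u ('D_v f) p = 'D_v ('D_u f) p.
Proof.
move=> sf Dp.
have close u1 v1 (e : R) : 0 < e -> exists2 d : R, 0 < d &
    forall s t : R, 0 <= s <= d -> 0 <= t <= d ->
      D (p + s *: u1 + t *: v1) /\
      `|'D_v1 ('D_u1 f) (p + s *: u1 + t *: v1) - 'D_v1 ('D_u1 f) p| < e.
  move=> e0.
  have cF : {for p, continuous ('D_v1 ('D_u1 f))}.
    by apply: smooth_continuous Dp => //; exact/smooth_derive/smooth_derive.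
  have nP : \forall q \near p, D q /\
      `|'D_v1 ('D_u1 f) q - 'D_v1 ('D_u1 f) p| < e.
    near=> q; split; first by near: q; exact: near_D.
    by rewrite distrC; near: q; move/cvgrPdist_lt : cF; apply.
  have cline : {for (0, 0) : R * R,
      continuous (fun z : R * R => p + z.1 *: u1 + z.2 *: v1)}.
    apply: continuousD; first apply: continuousD.
    - exact: cst_continuous.
    - by apply: continuousZl; exact: cvg_fst.
    - by apply: continuousZl; exact: cvg_snd.
  have := cline _; rewrite /= !scale0r !addr0 => /(_ _ nP).
  move=> -[[A B] /= [[a /= a0 Aa] [b /= b0 Bb]] AB].
  (* Half the radii, because the square of side d is closed and the balls are open. *)
  pose d := Num.min (a / 2) (b / 2).
  have d0 : 0 < d by rewrite lt_min !divr_gt0.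
  exists d => // s t /andP[s0 sd] /andP[t0 td].
  apply: (AB (s, t)); split=> /=.
  - apply: Aa; rewrite /= sub0r normrN ger0_norm//.
    by move: sd; rewrite le_min => /andP[sd _]; lra.
  - apply: Bb; rewrite /= sub0r normrN ger0_norm//.
    by move: td; rewrite le_min => /andP[_ td]; lra.
apply/eqP; rewrite -subr_eq0 -normr_le0 leNgt; apply/negP.
(* e is the distance between the two mixed derivatives at p. If it were positive, approximating each
   within e / 2 by one common value would give e < e. *)
move eE : `|_| => e e0.
have [d d0 Pd] := close u v (e / 2) ltac:(lra).
have [d' d'0 Pd'] := close v u (e / 2) ltac:(lra).
have [r [r0 rd rd']] : exists r : R, [/\ 0 < r, r <= d & r <= d'].
  by exists (Num.min d d'); rewrite lt_min d0 d'0 !ge_min !lexx orbT.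
have sub_d (x : R) : 0 <= x <= r -> 0 <= x <= d.
  by move=> /andP[-> xr]; exact: le_trans xr rd.
have sub_d' (x : R) : 0 <= x <= r -> 0 <= x <= d'.
  by move=> /andP[-> xr]; exact: le_trans xr rd'.
have [|s [t [sr tr E1]]] := @second_difference _ _ D f u v p r sf r0.
  by move=> x y /sub_d xd /sub_d yd; have [] := Pd x y xd yd.
have [|s' [t' [sr' tr' E2]]] := @second_difference _ _ D f v u p r sf r0.
  by move=> x y /sub_d' xd /sub_d' yd; have [] := Pd' x y xd yd.
(* The second difference is symmetric in u and v, so its two mean value forms agree. *)
have E : 'D_v ('D_u f) (p + s *: u + t *: v) =
         'D_u ('D_v f) (p + s' *: v + t' *: u).
  apply: (@mulIf _ (r ^+ 2)); first by rewrite expf_neq0// gt_eqF.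
  apply: (etrans (esym E1)); apply: etrans E2.
  congr (_ - _ + _); last exact: addrC.
  by congr f; exact: addrAC.
have [_ H1] := Pd s t (sub_d _ sr) (sub_d _ tr).
have [_ H2] := Pd' s' t' (sub_d' _ sr') (sub_d' _ tr').
rewrite -E in H2; suff : e < e by rewrite ltxx.
rewrite -{1}eE; apply: (le_lt_trans (ler_distD _ _ _)).
rewrite [ltRHS](splitr e); apply: ltrD H1; rewrite distrC; exact: H2.
Unshelve. all: by end_near. Qed.

End Schwarz.

(** * Derivations and their commutators *)

Section Derivations.
Variables (R : realType) (V : normedModType R) (D : set V).
Implicit Types (f g : V -> R) (X Y Z : (V -> R) -> V -> R) (p : V).

(** [der_ext] expresses locality: an identity known only on D may be differentiated there, whatever
    the total functions do elsewhere. *)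
Record derivation X : Prop := Derivation {
  der_smooth : forall f, smooth D f -> smooth D (X f);
  der_ext : forall f g p, D p -> (forall q, D q -> f q = g q) -> X f p = X g p;
  der_cst : forall c p, D p -> X (fun=> c) p = 0;
  derD : forall f g p, D p -> smooth D f -> smooth D g ->
    X (fun q => f q + g q) p = X f p + X g p;
  derM : forall f g p, D p -> smooth D f -> smooth D g ->
    X (fun q => f q * g q) p = X f p * g p + f p * X g p }.

Lemma derivation_derive v : open D -> derivation (fun f => 'D_v f).
Proof.
move=> openD; split.
- by move=> f; exact: smooth_derive.
- by move=> f g p; exact: derive_ext.
- by move=> c p _; exact: derive_cst.
- by move=> f g p Dp sf sg; apply: deriveD; exact: smooth_derivable Dp.
- move=> f g p Dp sf sg; rewrite [LHS]deriveM; try exact: smooth_derivable Dp.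
  by rewrite addrC [g p *: _]mulrC.
Qed.

Section DerivationTheory.
Variable X : (V -> R) -> V -> R.
Hypothesis (openD : open D) (dX : derivation X).

Lemma derZ c f p : D p -> smooth D f -> X (fun q => c * f q) p = c * X f p.
Proof.
move=> Dp sf; rewrite (derM dX Dp (smooth_cst openD c) sf) (der_cst dX)//.
by rewrite mul0r add0r.
Qed.

Lemma derN f p : D p -> smooth D f -> X (fun q => - f q) p = - X f p.
Proof.
move=> Dp sf; rewrite -[RHS]mulN1r -derZ//; apply: (der_ext dX) => // q _.
by rewrite mulN1r.
Qed.

Lemma derB f g p : D p -> smooth D f -> smooth D g ->
  X (fun q => f q - g q) p = X f p - X g p.
Proof. by move=> Dp sf sg; rewrite (derD dX Dp sf (smoothN openD sg)) derN. Qed.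

Lemma der_sum (I : Type) (r : seq I) (F : I -> V -> R) p : D p ->
  (forall i, smooth D (F i)) ->
  X (fun q => \sum_(i <- r) F i q) p = \sum_(i <- r) X (F i) p.
Proof.
move=> Dp sF; elim: r => [|i r IHr].
  rewrite big_nil; apply: etrans (der_cst dX 0 Dp).
  apply: (der_ext dX) => // q _.
  by rewrite big_nil.
rewrite big_cons -IHr -(derD dX Dp)//; last exact: smooth_sum.
by apply: (der_ext dX) => // q _; rewrite big_cons.
Qed.

End DerivationTheory.

Section Adapted.
Variables (m : nat) (B : 'I_m -> (V -> R) -> V -> R).
Hypotheses (openD : open D) (dB : forall j, derivation (B j)).
Implicit Types (c : 'I_m -> V -> R).

(** In use, the lift of a coordinate field A by a nonlinear connection: the B j are the fields
    d/dy^j and the c j its coefficients. *)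
Definition adapt A c f p := A f p - \sum_(j < m) c j p * B j f p.

Lemma derivation_adapt A c : derivation A -> (forall j, smooth D (c j)) ->
  derivation (adapt A c).
Proof.
move=> dA sc; have sM j f : smooth D f -> smooth D (fun p => c j p * B j f p).
  by move=> sf; apply: smoothM => //; exact: der_smooth.
split.
- move=> f sf; apply: smoothB => //; first exact: der_smooth.
  by apply: smooth_sum => // j _; exact: sM.
- move=> f g p Dp fg; rewrite /adapt (der_ext dA Dp fg); congr (_ - _).
  by apply: eq_bigr => j _; rewrite (der_ext (dB j) Dp fg).
- move=> k p Dp; rewrite /adapt (der_cst dA)// big1 ?subr0// => j _.
  by rewrite (der_cst (dB j))// mulr0.
- move=> f g p Dp sf sg; rewrite /adapt (derD dA)// addrACA -opprD -big_split.
  by congr (_ - _); apply: eq_bigr => j _; rewrite (derD (dB j))// mulrDr.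
- move=> f g p Dp sf sg; rewrite /adapt (derM dA)//.
  under eq_bigr => j _ do
    rewrite (derM (dB j))// mulrDr mulrA (mulrCA (c j p) (f p)).
  rewrite big_split /= -mulr_suml -mulr_sumr; ring.
Qed.

Definition commute_on X Y := forall f p, D p -> smooth D f ->
  X (Y f) p = Y (X f) p.

(** Z passes through A and through every B j, so the bracket only keeps the derivatives of the
    coefficients. *)
Lemma adapt_comm_vertical Z A c f p : derivation Z -> derivation A ->
  (forall j, smooth D (c j)) ->
  commute_on Z A -> (forall j, commute_on Z (B j)) -> D p -> smooth D f ->
  Z (adapt A c f) p = adapt A c (Z f) p - \sum_(j < m) Z (c j) p * B j f p.
Proof.
move=> dZ dA sc ZA ZB Dp sf.
have sM j : smooth D (fun p => c j p * B j f p).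
  by apply: smoothM => //; exact: der_smooth.
rewrite /adapt derB//; [|exact: der_smooth|exact: smooth_sum].
rewrite der_sum// ZA// -addrA -opprD -big_split /=; congr (_ - _).
apply: eq_bigr => j _; rewrite (derM dZ)//; last exact: der_smooth.
by rewrite ZB// addrC.
Qed.

(** The second-order terms cancel because the underlying fields commute. What remains is vertical,
    and its coefficients are the curvature of the connection. *)
Lemma adapt_comm A A' c c' f p : derivation A -> derivation A' ->
  (forall j, smooth D (c j)) -> (forall j, smooth D (c' j)) ->
  commute_on A A' -> (forall j, commute_on A (B j)) ->
  (forall j, commute_on A' (B j)) -> (forall i j, commute_on (B i) (B j)) ->
  D p -> smooth D f ->
  adapt A c (adapt A' c' f) p - adapt A' c' (adapt A c f) p =
  \sum_(j < m) (adapt A' c' (c j) p - adapt A c (c' j) p) * B j f p.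
Proof.
move=> dA dA' sc sc' AA' AB A'B BB Dp sf.
have dY := derivation_adapt dA' sc'.
have sB j : smooth D (B j f) by exact: der_smooth.
have sM j : smooth D (fun p => c j p * B j f p) by exact: smoothM.
have -> : adapt A c (adapt A' c' f) p =
    adapt A' c' (A f) p - \sum_j A (c' j) p * B j f p
    - \sum_j (c j p * adapt A' c' (B j f) p
              - \sum_i c j p * B j (c' i) p * B i f p).
  rewrite {1}/adapt (adapt_comm_vertical dA)//; congr (_ - _).
  apply: eq_bigr => j _; rewrite (adapt_comm_vertical (dB j) dA')//; last first.
    by move=> g q Dq sg; rewrite A'B.
  rewrite mulrBr mulr_sumr; congr (_ - _).
  by apply: eq_bigr => i _; rewrite mulrA.
(* Here only the inner operator is opened, with the Leibniz rule for the whole of [adapt A' c'], so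
   that the terms in [adapt A' c' (A f)] and [adapt A' c' (B j f)] cancel unexpanded against those
   above. *)
have -> : adapt A' c' (adapt A c f) p =
    adapt A' c' (A f) p - \sum_j (adapt A' c' (c j) p * B j f p
                                  + c j p * adapt A' c' (B j f) p).
  rewrite {1}[adapt A c f]/adapt derB//; [|exact: der_smooth|exact: smooth_sum].
  by rewrite der_sum//; congr (_ - _); apply: eq_bigr => j _; rewrite (derM dY).
have -> : \sum_j (adapt A' c' (c j) p - adapt A c (c' j) p) * B j f p =
    \sum_j adapt A' c' (c j) p * B j f p - \sum_j A (c' j) p * B j f p
    + \sum_j \sum_i c j p * B j (c' i) p * B i f p.
  rewrite exchange_big -sumrB -big_split; apply: eq_bigr => j _ /=.
  rewrite -mulr_suml [adapt A c _ _]/adapt; ring.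
rewrite sumrB big_split /=; ring.
Qed.

End Adapted.
End Derivations.

(** * The Maxwell equations for abstract derivations *)

Lemma sum_delta (R : pzSemiRingType) (n : nat) (a : 'I_n -> R) (j : 'I_n) :
  \sum_l a l * (l == j)%:R = a j.
Proof.
rewrite (bigD1 j)//= eqxx mulr1 big1 ?addr0// => l lj.
by rewrite (negPf lj) mulr0.
Qed.

(* Xt, Xx k and Xy k stand for the derivations d/dt, d/dx^k and d/dy^k of the
   adapted basis, K m i j for dN^m_j/dy^i, and the other letters for the
   components that they denote in the theorem; only the structure equations
   are assumed. *)
Section FormalMaxwell.
Variables (R : realType) (V : normedModType R) (D : set V) (n : nat).
Implicit Types (f : V -> R) (p : V) (i j k l m r : 'I_n).

Variables (Xt : (V -> R) -> V -> R) (Xx Xy : 'I_n -> (V -> R) -> V -> R).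
Variables (G Gc N : 'I_n -> 'I_n -> V -> R) (y : 'I_n -> V -> R) (H : V -> R).
Variables (Lc Cc Rx K : 'I_n -> 'I_n -> 'I_n -> V -> R).
Variables (Rt : 'I_n -> 'I_n -> V -> R).

Hypotheses (openD : open D) (dXt : derivation D Xt).
Hypotheses (dXx : forall k, derivation D (Xx k)).
Hypotheses (dXy : forall k, derivation D (Xy k)).
Hypotheses (sG : forall i j, smooth D (G i j)) (sy : forall i, smooth D (y i)).
Hypotheses (sGc : forall i j, smooth D (Gc i j)) (sH : smooth D H).
Hypothesis Gsym : forall p, D p -> forall i j, G i j p = G j i p.
Hypothesis XyG : forall p, D p -> forall m i j, Xy m (G i j) p = Xy i (G m j) p.
Hypothesis lowL : forall p, D p -> forall l i m,
  \sum_r G l r p * Lc r i m p =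
  2^-1 * (Xx m (G i l) p + Xx i (G m l) p - Xx l (G i m) p).
Hypothesis lowC : forall p, D p -> forall l i m,
  \sum_r G l r p * Cc r i m p = 2^-1 * Xy m (G i l) p.
(** The H term compensates for X_t h^11, since the coefficients [Gc] are built from X_t g whereas G
    = h^11 g. *)
Hypothesis lowG : forall p, D p -> forall l i,
  \sum_r G l r p * Gc r i p = 2^-1 * Xt (G l i) p + H p * G l i p.
Hypothesis Lsym : forall p, D p -> forall r i j, Lc r i j p = Lc r j i p.
Hypothesis Csym : forall p, D p -> forall r i j, Cc r i j p = Cc r j i p.
Hypothesis Xty : forall p, D p -> forall i, Xt (y i) p = H p * y i p.
Hypothesis Xxy : forall p, D p -> forall k i, Xx k (y i) p = - N i k p.
Hypothesis Xyy : forall p, D p -> forall k i, Xy k (y i) p = (i == k)%:R.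
Hypothesis XxH : forall p, D p -> forall k, Xx k H p = 0.
Hypothesis XxXx : forall f p, D p -> smooth D f -> forall i j,
  Xx i (Xx j f) p - Xx j (Xx i f) p = \sum_m Rx m i j p * Xy m f p.
Hypothesis XtXx : forall f p, D p -> smooth D f -> forall j,
  Xt (Xx j f) p - Xx j (Xt f) p = \sum_m Rt m j p * Xy m f p.
Hypothesis XyXx : forall f p, D p -> smooth D f -> forall i j,
  Xy i (Xx j f) p = Xx j (Xy i f) p - \sum_m K m i j p * Xy m f p.
Hypothesis Ksym : forall p, D p -> forall m i j, K m i j p = K m j i p.
Hypothesis Bianchi : forall p, D p -> forall i j k,
  \sum_m G i m p * Rx m j k p + \sum_m G j m p * Rx m k i p
  + \sum_m G k m p * Rx m i j p = 0.

Definition yl i p := \sum_r G i r p * y r p.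
Definition Dt i p := \sum_r G i r p * \sum_m Gc r m p * y m p.
Definition Dx i k p := \sum_r G i r p * (- N r k p + \sum_m Lc r m k p * y m p).
Definition Dy i k p :=
  \sum_r G i r p * ((r == k)%:R + \sum_m Cc r m k p * y m p).
Definition em i j p := 2^-1 * (Dx i j p - Dx j i p).

Lemma syl i : smooth D (yl i).
Proof.
by apply: (smooth_sum openD) => r _; apply: (smoothM openD).
Qed.

Lemma der_G_sym X p i j : derivation D X -> D p -> X (G i j) p = X (G j i) p.
Proof. by move=> dX Dp; apply: (der_ext dX Dp) => q Dq; exact: Gsym. Qed.

(** Symmetry of G moves the lowering from y to the coefficients, where [lowL], [lowC] and [lowG]
    apply. *)
Lemma sum_yl p (c : 'I_n -> R) : D p ->
  \sum_r c r * yl r p = \sum_m (\sum_r G m r p * c r) * y m p.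
Proof.
move=> Dp; under eq_bigr => r _ do rewrite mulr_sumr.
rewrite exchange_big; apply: eq_bigr => m _; rewrite mulr_suml.
by apply: eq_bigr => r _; rewrite (Gsym Dp m r) mulrA [c r * _]mulrC.
Qed.

Lemma lower_sum p i (c : 'I_n -> 'I_n -> R) :
  \sum_r G i r p * (\sum_m c r m * y m p) =
  \sum_m (\sum_r G i r p * c r m) * y m p.
Proof.
under eq_bigr => r _ do rewrite mulr_sumr.
rewrite exchange_big; apply: eq_bigr => m _; rewrite mulr_suml.
by apply: eq_bigr => r _; rewrite mulrA.
Qed.

Lemma der_yl X i p : derivation D X -> D p ->
  X (yl i) p = \sum_r G i r p * X (y r) p + \sum_r X (G i r) p * y r p.
Proof.
move=> dX Dp; rewrite (der_sum openD dX)//; last first.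
  by move=> r; exact: smoothM.
by rewrite -big_split; apply: eq_bigr => r _; rewrite (derM dX)// addrC.
Qed.

(* The connection is metrical: Dx i k is the covariant derivative of y_i. *)
Lemma Xx_yl k i p : D p ->
  Xx k (yl i) p = Dx i k p + \sum_r Lc r i k p * yl r p.
Proof.
move=> Dp; rewrite (der_yl i (dXx k) Dp) sum_yl// /Dx.
under [X in _ = X + _]eq_bigr => r _ do rewrite mulrDr.
rewrite big_split /= lower_sum -addrA; congr (_ + _).
  by apply: eq_bigr => r _; rewrite Xxy.
(* The Christoffel sums lowered at i and at m add up to X_k G_im. *)
rewrite -big_split /=; apply: eq_bigr => m _; rewrite -mulrDl; congr (_ * _).
rewrite !lowL// (der_G_sym i m (dXx k) Dp) (der_G_sym k i (dXx m) Dp).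
rewrite (der_G_sym k m (dXx i) Dp). lra.
Qed.

Lemma Xy_yl k i p : D p ->
  Xy k (yl i) p = Dy i k p + \sum_r Cc r i k p * yl r p.
Proof.
move=> Dp; rewrite (der_yl i (dXy k) Dp) sum_yl// /Dy.
under [X in _ = X + _]eq_bigr => r _ do rewrite mulrDr.
rewrite big_split /= lower_sum -addrA; congr (_ + _).
  by apply: eq_bigr => r _; rewrite Xyy.
rewrite -big_split /=; apply: eq_bigr => m _; rewrite -mulrDl; congr (_ * _).
rewrite !lowC// (der_G_sym i m (dXy k) Dp); by field.
Qed.

Lemma Xy_ylE k i p : D p ->
  Xy k (yl i) p = G i k p + \sum_r Xy k (G i r) p * y r p.
Proof.
move=> Dp; rewrite (der_yl i (dXy k) Dp); congr (_ + _).
under eq_bigr => r _ do rewrite Xyy//.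
by rewrite (sum_delta (fun r => G i r p)).
Qed.

(** Total symmetry of the vertical derivatives of G makes the vertical Jacobian of y_i symmetric,
    which is what the vertical Maxwell equation rests on. *)
Lemma Xy_yl_sym k i p : D p -> Xy k (yl i) p = Xy i (yl k) p.
Proof.
move=> Dp; rewrite !Xy_ylE// (Gsym Dp i k); congr (_ + _).
by apply: eq_bigr => r _; rewrite (XyG Dp k i r).
Qed.

(** By [lowG] the lowered coefficients of [Gc] are symmetric, so [Gc] can be contracted with y_r
    instead of y^r. *)
Lemma Dt_yl i p : D p -> Dt i p = \sum_r Gc r i p * yl r p.
Proof.
move=> Dp; rewrite /Dt lower_sum sum_yl//; apply: eq_bigr => m _.
by rewrite !lowG// (der_G_sym i m dXt Dp) (Gsym Dp i m).
Qed.

(** By [lowG], twice [Dt i] is (X_t G_ir) y^r + 2 H y_i, whereas the Leibniz rule for y_i yields H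
    y_i only once. *)
Lemma Xt_yl i p : D p -> Xt (yl i) p = 2 * Dt i p - H p * yl i p.
Proof.
move=> Dp; rewrite (der_yl i dXt Dp) /Dt lower_sum /yl !mulr_sumr -sumrB.
rewrite -big_split /=; apply: eq_bigr => r _; rewrite lowG// Xty//; by field.
Qed.

Lemma emE i j p : D p -> em i j p = 2^-1 * (Xx j (yl i) p - Xx i (yl j) p).
Proof.
move=> Dp; rewrite !Xx_yl// /em.
under [X in _ = _ * (_ - (_ + X))]eq_bigr => r _ do rewrite Lsym//.
by congr (_ * _); ring.
Qed.

Lemma em_anti i j p : em i j p = - em j i p.
Proof. by rewrite /em -mulrN opprB. Qed.

Lemma der_em X i j p : derivation D X -> D p ->
  X (em i j) p = 2^-1 * (X (Xx j (yl i)) p - X (Xx i (yl j)) p).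
Proof.
move=> dX Dp.
have s k l : smooth D (Xx k (yl l)) := der_smooth (dXx k) (syl l).
rewrite -(derB openD dX Dp (s j i) (s i j)).
rewrite -(derZ openD dX _ Dp (smoothB openD (s j i) (s i j))).
by apply: (der_ext dX Dp) => q; exact: emE.
Qed.

Lemma smooth_Dt i : smooth D (Dt i).
Proof.
apply: (smooth_sum openD) => r _; apply: (smoothM openD) => //.
by apply: (smooth_sum openD) => m _; exact: smoothM.
Qed.

Lemma Xx_Xt_yl k i p : D p ->
  Xx k (Xt (yl i)) p = 2 * Xx k (Dt i) p - H p * Xx k (yl i) p.
Proof.
move=> Dp; have sD := smooth_Dt i; have sY := syl i.
rewrite (der_ext (dXx k) Dp (Xt_yl i)) (derB openD (dXx k) Dp); last first.
- exact: smoothM.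
- by apply: (smoothM openD) => //; exact: smooth_cst.
by rewrite (derZ openD (dXx k))// (derM (dXx k))// XxH// mul0r add0r.
Qed.

Lemma Xx_Dt k i p : D p ->
  Xx k (Dt i) p = \sum_r Xx k (Gc r i) p * yl r p
                  + \sum_r Gc r i p * Xx k (yl r) p.
Proof.
move=> Dp; have sY := syl; rewrite (der_ext (dXx k) Dp (Dt_yl i)).
rewrite (der_sum openD (dXx k))//; last by move=> r; exact: smoothM.
by rewrite -big_split; apply: eq_bigr => r _; rewrite (derM (dXx k)).
Qed.

Definition em_x i j k p := Xx k (em i j) p
  - \sum_m Lc m i k p * em m j p - \sum_m Lc m j k p * em i m p.
Definition em_y i j k p := Xy k (em i j) p
  - \sum_m Cc m i k p * em m j p - \sum_m Cc m j k p * em i m p.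
(** The term in H appears because the first index of F is vertical, where the connection coefficient
    is [Gc] minus a multiple H of the identity. *)
Definition em_t i k p := Xt (em i k) p + H p * em i k p
  - \sum_m Gc m i p * em m k p - \sum_m Gc m k p * em i m p.
Definition Dtx i k p := Xx k (Dt i) p - \sum_m Lc m i k p * Dt m p.
Definition Ttx m i k p := - Xx k (Gc m i) p
  - \sum_r Lc m r k p * Gc r i p + \sum_r Lc r i k p * Gc m r p.

Lemma cyclic_em_x i j k p : D p ->
  em_x i j k p + em_x j k i p + em_x k i j p =
  - (\sum_l \sum_m 2^-1 * Xy m (G i l) p * Rx m j k p * y l p
     + \sum_l \sum_m 2^-1 * Xy m (G j l) p * Rx m k i p * y l p
     + \sum_l \sum_m 2^-1 * Xy m (G k l) p * Rx m i j p * y l p).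
Proof.
move=> Dp; pose U a b c := \sum_m Lc m a b p * em m c p.
have Usym a b c : U a b c = U b a c.
  by apply: eq_bigr => m _; rewrite Lsym.
(* Since F is antisymmetric, its second connection term is again a U, with the opposite sign; by
   [Usym] the U terms cancel in the cyclic sum. *)
have em_xE a b c : em_x a b c p = Xx c (em a b) p - U a c b + U b c a.
  rewrite /em_x -/(U _ _ _) -[in RHS](opprK (U b c a)); congr (_ - _).
  by rewrite /U -sumrN; apply: eq_bigr => m _; rewrite em_anti mulrN.
pose Z a b c := \sum_l \sum_m 2^-1 * Xy m (G a l) p * Rx m b c p * y l p.
(* The bracket is vertical and acts on y_a through G_am + (Y_m G_al) y^l. The G part disappears by
   [Bianchi]; the factor 2 before Z is undone by the 1/2 in F. *)
have C a b c : Xx b (Xx c (yl a)) p - Xx c (Xx b (yl a)) p =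
    \sum_m G a m p * Rx m b c p + 2 * Z a b c.
  rewrite XxXx//; last exact: syl.
  rewrite /Z exchange_big mulr_sumr -big_split; apply: eq_bigr => m _ /=.
  rewrite Xy_ylE// mulrDr mulrC mulr_sumr mulr_sumr; congr (_ + _).
  by apply: eq_bigr => l _; by field.
rewrite !em_xE !(der_em _ _ (dXx _) Dp) (Usym k i) (Usym j i) (Usym k j).
rewrite -!/(Z _ _ _).
have := Bianchi Dp i j k; have := C i j k; have := C j k i; have := C k i j.
move: (Z i j k) (Z j k i) (Z k i j) => z1 z2 z3.
lra.
Qed.

Lemma cyclic_em_y i j k p : D p ->
  em_y i j k p + em_y j k i p + em_y k i j p = 0.
Proof.
move=> Dp; pose U a b c := \sum_m Cc m a b p * em m c p.
have Usym a b c : U a b c = U b a c.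
  by apply: eq_bigr => m _; rewrite Csym.
have em_yE a b c : em_y a b c p = Xy c (em a b) p - U a c b + U b c a.
  rewrite /em_y -/(U _ _ _) -[in RHS](opprK (U b c a)); congr (_ - _).
  by rewrite /U -sumrN; apply: eq_bigr => m _; rewrite em_anti mulrN.
(* Moving Y_a inside X_b costs W, symmetric in a and b, and leaves Z, symmetric in its last two
   indices. The antisymmetrised cyclic sum kills both. *)
pose W a b c := \sum_m K m a b p * Xy m (yl c) p.
have Wsym a b c : W a b c = W b a c.
  by apply: eq_bigr => m _; rewrite Ksym.
pose Z a b c := Xx a (Xy b (yl c)) p.
have Zsym a b c : Z a b c = Z a c b.
  by apply: (der_ext (dXx a) Dp) => q; exact: Xy_yl_sym.
have C a b c : Xy a (Xx b (yl c)) p = Z b a c - W a b c.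
  by rewrite XyXx//; exact: syl.
rewrite !em_yE !(der_em _ _ (dXy _) Dp) !C (Usym k i) (Usym j i) (Usym k j).
rewrite (Wsym k j) (Wsym k i) (Wsym j i) (Zsym j k) (Zsym i k) (Zsym k j).
ring.
Qed.

Lemma em_t_Maxwell i k p : D p -> em_t i k p =
  2^-1 * ((Dtx i k p + \sum_m Dx i m p * - Gc m k p + \sum_m Dy i m p * Rt m k p
           - \sum_r (Ttx r i k p + \sum_m Cc r k m p * Rt m i p) * yl r p)
        - (Dtx k i p + \sum_m Dx k m p * - Gc m i p + \sum_m Dy k m p * Rt m i p
           - \sum_r (Ttx r k i p + \sum_m Cc r i m p * Rt m k p) * yl r p)).
Proof.
move=> Dp.
pose P a b := \sum_r Gc r a p * Dx r b p.
pose Q a b := \sum_r Gc r b p * Dx a r p.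
pose U a b := \sum_m Lc m a b p * Dt m p.
pose Y a b := \sum_m Dy a m p * Rt m b p.
pose Y' a b := \sum_m (\sum_r Cc r a m p * yl r p) * Rt m b p.
have Usym a b : U a b = U b a by apply: eq_bigr => m _; rewrite Lsym.
(* Contracted with y_r, the derivative of T produces a second copy of X_b [Dt]. Together with the
   one in [Dtx] it matches the 2 [Dt] in [Xt_yl]. *)
have TE a b : \sum_r Ttx r a b p * yl r p = - Xx b (Dt a) p + P a b + U a b.
  rewrite Xx_Dt// /Ttx.
  under eq_bigr => r _ do rewrite mulrDl mulrBl mulNr.
  rewrite big_split /= big_split /= !sumrN.
  under [X in _ = - (_ + X) + _ + _]eq_bigr => r _ do rewrite Xx_yl// mulrDr.
  rewrite big_split /= -/(P a b).
  have -> : U a b = \sum_r (\sum_m Lc m a b p * Gc r m p) * yl r p.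
    rewrite /U; under eq_bigr => m _ do rewrite Dt_yl// mulr_sumr.
    rewrite exchange_big; apply: eq_bigr => r _; rewrite mulr_suml.
    by apply: eq_bigr => m _; rewrite mulrA.
  have -> : \sum_r (\sum_m Lc r m b p * Gc m a p) * yl r p =
      \sum_r Gc r a p * \sum_m Lc m r b p * yl m p.
    under eq_bigr => r _ do rewrite mulr_suml.
    rewrite exchange_big; apply: eq_bigr => r _; rewrite mulr_sumr.
    by apply: eq_bigr => m _; rewrite mulrA [Gc _ _ _ * _]mulrC.
  ring.
have CE a b : \sum_r (\sum_m Cc r a m p * Rt m b p) * yl r p = Y' a b.
  under eq_bigr => r _ do rewrite mulr_suml.
  rewrite exchange_big; apply: eq_bigr => m _; rewrite mulr_suml.
  by apply: eq_bigr => r _; rewrite mulrAC.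
have RE a b : \sum_m Rt m b p * Xy m (yl a) p = Y a b + Y' a b.
  rewrite -big_split; apply: eq_bigr => m _ /=.
  by rewrite Xy_yl// -mulrDl mulrC.
have XtE a b : Xt (Xx b (yl a)) p =
    2 * Xx b (Dt a) p - H p * Xx b (yl a) p + (Y a b + Y' a b).
  by rewrite -RE -(Xx_Xt_yl b a Dp) -(XtXx Dp (syl a)); ring.
have GF a b : \sum_m Gc m a p * em m b p = 2^-1 * (P a b - Q b a).
  rewrite -sumrB mulr_sumr; apply: eq_bigr => m _; rewrite /em; ring.
have FG a b : \sum_m Gc m b p * em a m p = 2^-1 * (Q a b - P b a).
  rewrite -sumrB mulr_sumr; apply: eq_bigr => m _; rewrite /em; ring.
have DG a b : \sum_m Dx a m p * - Gc m b p = - Q a b.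
  by rewrite -sumrN; apply: eq_bigr => m _; rewrite mulrN mulrC.
(* The term Y' carries its indices in the reverse order; its minus sign in the equation and the
   alternation restore the order found in [RE]. *)
have SE a b : \sum_r (Ttx r a b p + \sum_m Cc r b m p * Rt m a p) * yl r p =
    - Xx b (Dt a) p + P a b + U a b + Y' b a.
  by rewrite -TE -CE -big_split; apply: eq_bigr => r _; rewrite mulrDl.
rewrite !SE !DG /em_t /Dtx GF FG (der_em _ _ dXt Dp) !XtE emE// (Usym k i).
rewrite -!/(Y _ _) -!/(U _ _) (Usym k i).
by field.
Qed.

End FormalMaxwell.

(** * The canonical nonlinear connection and the cyclic identity for its curvature *)

Section FormalSpray.
Variables (R : realType) (V : normedModType R) (D : set V) (n : nat).
Implicit Types (f : V -> R) (p : V) (i j k l m r : 'I_n).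

Variables (dt : (V -> R) -> V -> R) (dx dy : 'I_n -> (V -> R) -> V -> R).
Variables (L H : V -> R) (y spray : 'I_n -> V -> R).

Hypotheses (openD : open D) (ddt : derivation D dt).
Hypotheses (ddx : forall k, derivation D (dx k)).
Hypotheses (ddy : forall k, derivation D (dy k)).
Hypotheses (dt_dy : forall i, commute_on D dt (dy i)).
Hypotheses (dx_dx : forall i j, commute_on D (dx i) (dx j)).
Hypotheses (dx_dy : forall i j, commute_on D (dx i) (dy j)).
Hypotheses (dy_dy : forall i j, commute_on D (dy i) (dy j)).
Hypotheses (sL : smooth D L) (sH : smooth D H).
Hypotheses (sy : forall i, smooth D (y i)).
Hypotheses (sspray : forall i, smooth D (spray i)).
Hypothesis dyH : forall p, D p -> forall k, dy k H p = 0.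
Hypothesis dyy : forall p, D p -> forall k i, dy k (y i) p = (i == k)%:R.

Let G i j p := 2^-1 * dy i (dy j L) p.
Let N i j := dy j (spray i).
Let Xx k := adapt dy (dx k) (N ^~ k).

(** For H = H^1_11 this is the Euler-Lagrange expression of L sqrt|h_11|, divided by sqrt|h_11|,
    with dy^l/dt replaced by H y^l. *)
Definition Euler_form k p :=
  \sum_j dx j (dy k L) p * y j p - dx k L p + dt (dy k L) p + dy k L p * H p
  + \sum_l 2 * H p * G k l p * y l p.

Hypothesis sprayE : forall p, D p -> forall k,
  \sum_r G k r p * spray r p = 4^-1 * Euler_form k p.

Let sdL k : smooth D (dy k L). Proof. exact: der_smooth. Qed.
Let sG i j : smooth D (G i j).
Proof.
apply: (smoothM openD); first exact: smooth_cst.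
exact: (der_smooth (ddy i) (sdL j)).
Qed.
Let sN i j : smooth D (N i j).
Proof. exact: (der_smooth (ddy j) (sspray i)). Qed.
Let Gsym p i j : D p -> G i j p = G j i p.
Proof. by move=> Dp; rewrite /G dy_dy. Qed.
Let dyG p m i j : D p -> dy m (G i j) p = 2^-1 * dy m (dy i (dy j L)) p.
Proof.
move=> Dp; exact: (derZ openD (ddy m) _ Dp (der_smooth (ddy i) (sdL j))).
Qed.

Lemma dy_vertical_swap p m i j : D p -> dy m (G i j) p = dy i (G m j) p.
Proof. by move=> Dp; rewrite !dyG// (dy_dy m i Dp (sdL j)). Qed.

Lemma dy_Euler_form p i j : D p -> dy j (Euler_form i) p =
  \sum_l dx l (dy j (dy i L)) p * y l p + dx j (dy i L) p - dx i (dy j L) p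
  + dt (dy j (dy i L)) p + dy j (dy i L) p * H p
  + \sum_l 2 * H p * dy j (G i l) p * y l p + 2 * H p * G i j p.
Proof.
move=> Dp.
have s1 l : smooth D (dx l (dy i L)) := der_smooth (ddx l) (sdL i).
have s2 l : smooth D (fun p => dx l (dy i L) p * y l p) :=
  smoothM openD (s1 l) (sy l).
have s3 : smooth D (fun p => \sum_l dx l (dy i L) p * y l p).
  by apply: (smooth_sum openD).
have s4 := der_smooth (ddx i) sL.
have s5 := der_smooth ddt (sdL i).
have s6 := smoothM openD (sdL i) sH.
have s7 : smooth D (fun p => 2 * H p) := smoothM openD (smooth_cst openD 2) sH.
have s8 l : smooth D (fun p => 2 * H p * G i l p) := smoothM openD s7 (sG i l).
have s9 l : smooth D (fun p => 2 * H p * G i l p * y l p) :=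
  smoothM openD (s8 l) (sy l).
have s10 : smooth D (fun p => \sum_l 2 * H p * G i l p * y l p).
  by apply: (smooth_sum openD).
have s11 := smoothB openD s3 s4.
have s12 := smoothD openD s11 s5.
have s13 := smoothD openD s12 s6.
have dj := ddy j.
have E1 : dy j (fun p => \sum_l dx l (dy i L) p * y l p) p =
    \sum_l dx l (dy j (dy i L)) p * y l p + dx j (dy i L) p.
  rewrite (der_sum openD dj)//.
  under eq_bigr => l _ do
    rewrite (derM dj)// dyy// -(dx_dy l j Dp (sdL i)).
  by rewrite big_split /= (sum_delta (fun l => dx l (dy i L) p)).
have E2 : dy j (fun p => \sum_l 2 * H p * G i l p * y l p) p =
    \sum_l 2 * H p * dy j (G i l) p * y l p + 2 * H p * G i j p.
  rewrite (der_sum openD dj)//.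
  under eq_bigr => l _ do
    rewrite (derM dj)// (derM dj)// (derZ openD dj)// dyH// dyy// mulr0 mul0r
      add0r.
  by rewrite big_split /= (sum_delta (fun l => 2 * H p * G i l p)).
rewrite /Euler_form (derD dj Dp s13 s10) (derD dj Dp s12 s6).
rewrite (derD dj Dp s11 s5) (derB openD dj Dp s3 s4) E1 E2.
rewrite (derM dj Dp (sdL i) sH) dyH// mulr0.
rewrite -(dt_dy j Dp (sdL i)) -(dx_dy i j Dp sL).
ring.
Qed.

(** The terms not symmetric in i and j come from differentiating the factor y^l and from - dL/dx^i.
    Both contribute the same alternate difference, hence the 2. *)
Lemma dy_Euler_form_alternate p i j : D p ->
  dy j (Euler_form i) p - dy i (Euler_form j) p =
  2 * (dx j (dy i L) p - dx i (dy j L) p).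
Proof.
move=> Dp; rewrite !dy_Euler_form//.
have E1 l : dx l (dy j (dy i L)) p = dx l (dy i (dy j L)) p.
  by apply: (der_ext (ddx l) Dp) => q Dq; exact: dy_dy.
have E2 : dt (dy j (dy i L)) p = dt (dy i (dy j L)) p.
  by apply: (der_ext ddt Dp) => q Dq; exact: dy_dy.
under eq_bigr => l _ do rewrite E1.
under [X in _ + X + _ - _ = _]eq_bigr => l _ do rewrite dy_vertical_swap//.
rewrite E2 (Gsym i j Dp) (dy_dy j i Dp sL); ring.
Qed.

(* The canonical nonlinear connection is the one that makes the 2-form
   d(dL/dy^i) /\ dx^i free of horizontal components. *)
Lemma Xx_dL_sym p i j : D p -> Xx j (dy i L) p = Xx i (dy j L) p.
Proof.
move=> Dp.
(* Differentiating the lowered spray gives G N up to a term in dG/dy, which is symmetric in a and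
   b. *)
have A a b : \sum_r G a r p * N r b p =
    4^-1 * dy b (Euler_form a) p - \sum_r dy b (G a r) p * spray r p.
  have sGs r : smooth D (fun p => G a r p * spray r p).
    exact: smoothM.
  have sE : smooth D (Euler_form a).
    apply: (smooth_ext openD (f := fun p => 4 * \sum_r G a r p * spray r p)).
      by move=> q Dq; rewrite sprayE//; field.
    apply: (smoothM openD); first exact: smooth_cst.
    by apply: (smooth_sum openD).
  rewrite -(derZ openD (ddy b) _ Dp sE).
  rewrite -(der_ext (ddy b) Dp (fun q Dq => sprayE Dq a)).
  rewrite (der_sum openD (ddy b))// -sumrB; apply: eq_bigr => r _.
  by rewrite (derM (ddy b))// addrC addKr.
(* The vertical Hessian of L is 2 G. As 2 * (1/4) * 2 = 1, the factor 1/4 of the spray is exactly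
   the one that cancels the alternate part. *)
have XE a b : Xx b (dy a L) p = dx b (dy a L) p - 2 * \sum_r G a r p * N r b p.
  rewrite /Xx /adapt; congr (_ - _); rewrite mulr_sumr; apply: eq_bigr => r _.
  by rewrite /G (dy_dy a r Dp sL); field.
rewrite !XE !A; have := dy_Euler_form_alternate i j Dp.
under eq_bigr => r _ do rewrite dy_vertical_swap//.
lra.
Qed.

(** G_am R^m_bc is half the bracket of X_b and X_c applied to dL/dy^a; by [Xx_dL_sym] the six second
    derivatives cancel in pairs. *)
Lemma cyclic_curvature p i j k : D p ->
  let Rx m a b := Xx b (N m a) p - Xx a (N m b) p in
  \sum_m G i m p * Rx m j k + \sum_m G j m p * Rx m k i
  + \sum_m G k m p * Rx m i j = 0.
Proof.
move=> Dp Rx.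
have dX a : derivation D (Xx a).
  exact: (derivation_adapt openD ddy (ddx a) (sN ^~ a)).
have E a b c : \sum_m G a m p * Rx m b c =
    2^-1 * (Xx b (Xx c (dy a L)) p - Xx c (Xx b (dy a L)) p).
  rewrite /Xx (adapt_comm openD ddy (ddx b) (ddx c) (sN ^~ b) (sN ^~ c)
    (dx_dx b c) (dx_dy b) (dx_dy c) dy_dy Dp (sdL a)) mulr_sumr.
  by apply: eq_bigr => m _; rewrite /G (dy_dy a m Dp sL) /Rx /Xx; ring.
have S a b c : Xx a (Xx b (dy c L)) p = Xx a (Xx c (dy b L)) p.
  by apply: (der_ext (dX a) Dp) => q; exact: Xx_dL_sym.
rewrite !E (S j k i) (S k i j) (S i k j); ring.
Qed.

End FormalSpray.

(** * The jet space *)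

Section JetCalculus.
Variables (R : realType) (n : nat) (D : set (jet R n)).
Implicit Types (p : jet R n) (i j k l m : 'I_n).

Lemma is_derive_yc i p (v : jet R n) : is_derive p v (@yc R n i) (v.2 0 i).
Proof.
have E : \forall h \near 0^', h^-1 *: (yc i (h *: v + p) - yc i p) = v.2 0 i.
  near=> h; have h0 : h != 0 by near: h; exact: nbhs_dnbhs_neq.
  by rewrite /yc !mxE addrK [LHS]mulrA mulVf// mul1r.
split; first exact: is_cvg_near_cst E.
exact: lim_near_cst E.
Unshelve. all: by end_near. Qed.

Lemma derive_yc i p (v : jet R n) : 'D_v (yc i) p = v.2 0 i.
Proof. by have [_] := is_derive_yc i p v. Qed.

Lemma dt_yc i p : dt_ (yc i) p = 0.
Proof. by rewrite /dt_ derive_yc mxE. Qed.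

Lemma dx_yc j i p : dx_ j (yc i) p = 0.
Proof. by rewrite /dx_ derive_yc mxE. Qed.

Lemma dy_yc j i p : dy_ j (yc i) p = (i == j)%:R.
Proof. by rewrite /dy_ derive_yc mxE eqxx. Qed.

Lemma smooth_yc i : open D -> smooth D (yc i).
Proof.
move=> openD.
have c p : {for p, continuous (yc i)}.
  have := @continuous_comp _ _ _ (fun p : jet R n => p.2)
    (fun x : 'rV[R]_n => x 0 i) p.
  by apply; [exact: cvg_snd|exact: coord_continuous].
case=> [|k]; split=> //; split=> [p v _|v].
  by have [] := is_derive_yc i p v.
apply: Ck_ext (Ck_cst openD k (v.2 0 i)) => // p _.
by rewrite derive_yc.
Qed.

Lemma derivable_tc (f : R -> R) (v p : jet R n) :
  derivable (fun q => f (tc q)) p v = derivable f (tc p) (tc v).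
(* The projection [tc] commutes with translation and scaling by computation. *)
Proof. rewrite /derivable; reflexivity. Qed.

Lemma derive_tc (f : R -> R) (v p : jet R n) :
  'D_v (fun q => f (tc q)) p = 'D_(tc v) f (tc p).
Proof. rewrite /derive; reflexivity. Qed.

Lemma dt_tc (f : R -> R) p : dt_ (fun q => f (tc q)) p = derive1 f (tc p).
Proof. by rewrite derive1E /dt_ derive_tc. Qed.

Lemma dx_tc i (f : R -> R) p : dx_ i (fun q => f (tc q)) p = 0.
Proof. by rewrite /dx_ derive_tc derive0. Qed.

Lemma dy_tc i (f : R -> R) p : dy_ i (fun q => f (tc q)) p = 0.
Proof. by rewrite /dy_ derive_tc derive0. Qed.

Lemma smooth_tc (U : set R) (f : R -> R) : open D ->
  (forall p, D p -> U (tc p)) -> smooth U f -> smooth D (fun p => f (tc p)).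
Proof.
move=> openD DU sf k; elim: k f sf => [|k IHk] f sf; split=> //;
  try (move=> p Dp; apply: (@continuous_comp _ _ _ (@tc R n) f);
       [by apply: (continuous_comp (f := fst)); exact: cvg_fst
       |exact: smooth_continuous sf (DU p Dp)]).
split=> [p v Dp|v].
  by rewrite derivable_tc; exact: smooth_derivable (DU p Dp).
apply: (Ck_ext openD _ (IHk _ (smooth_derive (tc v) sf))) => p _.
by rewrite derive_tc.
Qed.

End JetCalculus.

(** * The structure equations in one coordinate domain *)

Section LocalGeometry.
Variables (R : realType) (n : nat) (S : local_data R n) (D : set (jet R n)).
Implicit Types (p : jet R n) (i j k l m : 'I_n) (f : jet R n -> R).

Hypotheses (openD : open D) (sL : smooth D (Lag S)).
Hypothesis sh : smooth D (fun p => h11 S (tc p)).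
Hypothesis h_neq0 : forall p, D p -> h11 S (tc p) != 0.
Hypothesis GvE : forall p, D p -> forall i j,
  Gv S i j p = hup S p * gij S i j p.
Hypothesis g_unit : forall p, D p -> gdn S p \in unitmx.

Lemma der_dt : derivation D (@dt_ R n).
Proof. exact: derivation_derive. Qed.

Lemma der_dx i : derivation D (dx_ i).
Proof. exact: derivation_derive. Qed.

Lemma der_dy i : derivation D (dy_ i).
Proof. exact: derivation_derive. Qed.
Hint Resolve der_dt der_dx der_dy : core.

Lemma dt_dx i : commute_on D (@dt_ R n) (dx_ i).
Proof. by move=> f p Dp sf; exact: derive_comm Dp. Qed.

Lemma dt_dy i : commute_on D (@dt_ R n) (dy_ i).
Proof. by move=> f p Dp sf; exact: derive_comm Dp. Qed.

Lemma dx_dx i j : commute_on D (dx_ i) (dx_ j).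
Proof. by move=> f p Dp sf; exact: derive_comm Dp. Qed.

Lemma dx_dy i j : commute_on D (dx_ i) (dy_ j).
Proof. by move=> f p Dp sf; exact: derive_comm Dp. Qed.

Lemma dy_dx i j : commute_on D (dy_ i) (dx_ j).
Proof. by move=> f p Dp sf; exact: derive_comm Dp. Qed.

Lemma dy_dy i j : commute_on D (dy_ i) (dy_ j).
Proof. by move=> f p Dp sf; exact: derive_comm Dp. Qed.

Lemma smooth_dL i : smooth D (dy_ i (Lag S)).
Proof. exact: der_smooth. Qed.

Lemma smooth_Gv i j : smooth D (Gv S i j).
Proof.
apply: smoothM => //; first exact: smooth_cst.
by apply: der_smooth => //; exact: smooth_dL.
Qed.

Lemma smooth_hup : smooth D (hup S).
Proof. exact: smoothV. Qed.

Lemma gijE p i j : D p -> gij S i j p = h11 S (tc p) * Gv S i j p.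
Proof. by move=> Dp; rewrite GvE// mulrA mulfV ?mul1r ?h_neq0. Qed.

(** The smoothness of g is inherited from L: on D, g is h_11 times half the vertical Hessian. *)
Lemma smooth_gij i j : smooth D (gij S i j).
Proof.
apply: (smooth_ext openD (f := fun p => h11 S (tc p) * Gv S i j p)).
  by move=> p Dp; rewrite gijE.
by apply: smoothM => //; exact: smooth_Gv.
Qed.

Lemma smooth_gup i j : smooth D (fun p => gup S p i j).
Proof. by apply: smooth_invmx => // k l; exact: smooth_gij. Qed.

Lemma smooth_H1 : smooth D (H1 S).
Proof.
apply: smoothM => //.
  by apply: smoothM => //; [exact: smooth_hup|exact: smooth_cst].
apply: (smooth_ext openD (f := @dt_ R n (fun p => h11 S (tc p)))).
  by move=> p Dp; exact: dt_tc.
exact: der_smooth.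
Qed.

Local Notation spray_form :=
  (Euler_form (@dt_ R n) (@dx_ R n) (@dy_ R n) (Lag S) (H1 S) (@yc R n)).

Lemma sprayE p i : D p ->
  spray S i p = \sum_k h11 S (tc p) * gup S p i k / 4 * spray_form k p.
Proof.
move=> Dp; apply: eq_bigr => k _; congr (_ * (_ + _)).
apply: eq_bigr => l _.
by rewrite [RHS](_ : _ = 2 * H1 S p * Gv S k l p * yc l p)// GvE// /gij; ring.
Qed.

Lemma smooth_spray_form k : smooth D (spray_form k).
Proof.
have sG := smooth_Gv; have sH := smooth_H1; have sdL := smooth_dL.
have sy i := smooth_yc i openD.
apply: (smoothD openD); last first.
  apply: (smooth_sum openD) => l _; apply: (smoothM openD); last exact: sy.
  apply: (smoothM openD); last exact: sG.
  by apply: (smoothM openD); first exact: (smooth_cst openD).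
apply: (smoothD openD); last by apply: (smoothM openD).
apply: (smoothD openD); last exact: der_smooth der_dt _ (sdL k).
apply: (smoothB openD); last exact: der_smooth (der_dx k) _ sL.
apply: (smooth_sum openD) => j _; apply: (smoothM openD); last exact: sy.
exact: der_smooth (der_dx j) _ (sdL k).
Qed.

Lemma smooth_spray i : smooth D (spray S i).
Proof.
apply: (smooth_ext openD (f := fun p =>
  \sum_k h11 S (tc p) * gup S p i k / 4 * spray_form k p)).
  by move=> p Dp; rewrite sprayE.
apply: (smooth_sum openD) => k _.
apply: (smoothM openD); last exact: smooth_spray_form.
apply: (smoothM openD); last exact: smooth_cst.
by apply: (smoothM openD); last exact: smooth_gup.
Qed.

Lemma smooth_Nc i j : smooth D (Nc S i j).
Proof. by apply: der_smooth => //; exact: smooth_spray. Qed.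

Lemma smooth_Mc i : smooth D (Mc S i).
Proof.
apply: smoothM => //; last exact: smooth_yc.
by apply: smoothN => //; exact: smooth_H1.
Qed.

Lemma der_adapted a : derivation D (adapted S a).
Proof.
case: a => [|i|i]; last exact: der_dy.
- exact: (derivation_adapt openD der_dy der_dt smooth_Mc).
- exact: (derivation_adapt openD der_dy (der_dx i) (smooth_Nc ^~ i)).
Qed.
Hint Resolve der_adapted : core.

Lemma adapted_x_x i j f p : D p -> smooth D f ->
  adapted S (Ax i) (adapted S (Ax j) f) p
  - adapted S (Ax j) (adapted S (Ax i) f) p =
  \sum_m Rx S m i j p * dy_ m f p.
Proof.
move=> Dp sf; apply: (adapt_comm openD der_dy (der_dx i) (der_dx j)
  (smooth_Nc ^~ i) (smooth_Nc ^~ j) _ _ _ _ Dp sf).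
- exact: dx_dx.
- exact: dx_dy.
- exact: dx_dy.
- exact: dy_dy.
Qed.

Lemma adapted_t_x j f p : D p -> smooth D f ->
  adapted S At (adapted S (Ax j) f) p - adapted S (Ax j) (adapted S At f) p =
  \sum_m Rt S m j p * dy_ m f p.
Proof.
move=> Dp sf; apply: (adapt_comm openD der_dy der_dt (der_dx j)
  smooth_Mc (smooth_Nc ^~ j) _ _ _ _ Dp sf).
- exact: dt_dx.
- exact: dt_dy.
- exact: dx_dy.
- exact: dy_dy.
Qed.

Lemma dy_adapted_x i j f p : D p -> smooth D f ->
  dy_ i (adapted S (Ax j) f) p =
  adapted S (Ax j) (dy_ i f) p - \sum_m dy_ i (Nc S m j) p * dy_ m f p.
Proof.
move=> Dp sf; apply: (adapt_comm_vertical openD der_dy (der_dy i) (der_dx j)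
  (smooth_Nc ^~ j) _ _ Dp sf).
- exact: dy_dx.
- exact: dy_dy.
Qed.

Lemma Gv_gup p k m : D p ->
  \sum_i Gv S k i p * gup S p i m = hup S p * (k == m)%:R.
Proof.
move=> Dp; under eq_bigr => i _ do rewrite GvE// /gij -mulrA.
rewrite -mulr_sumr; congr (_ * _).
by have /matrixP/(_ k m) := mulmxV (g_unit Dp); rewrite !mxE.
Qed.

(** Indices are raised with the inverse of g but lowered with h^11 g, so a factor h^11 survives. *)
Lemma lower p l (F : 'I_n -> R) : D p ->
  \sum_i Gv S l i p * (\sum_m gup S p i m / 2 * F m) = hup S p / 2 * F l.
Proof.
move=> Dp; under eq_bigr => i _ do rewrite mulr_sumr.
rewrite exchange_big (bigD1 l)//= [X in _ + X]big1 ?addr0 => [|m ml].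
  under eq_bigr => i _ do rewrite !mulrA.
  by rewrite -!mulr_suml Gv_gup// eqxx mulr1.
under eq_bigr => i _ do rewrite !mulrA.
by rewrite -!mulr_suml Gv_gup// eq_sym (negPf ml) mulr0 !mul0r.
Qed.

Lemma lower_spray p k : D p ->
  \sum_r Gv S k r p * spray S r p = 4^-1 * spray_form k p.
Proof.
move=> Dp; have h0 := h_neq0 Dp.
under eq_bigr => r _.
  (* The factor h_11 / 4 is split to fit [lower], whose h^11 then cancels h_11 and leaves 1/4. *)
  rewrite sprayE// (_ : \sum_k _ = \sum_m gup S p r m / 2
    * (h11 S (tc p) / 2 * spray_form m p)); last first.
    by apply: eq_bigr => m _; field.
  over.
by rewrite (lower _ _ Dp) /hup; field.
Qed.

Lemma Gv_sym p i j : D p -> Gv S i j p = Gv S j i p.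
Proof. by move=> Dp; rewrite /Gv /vertical_metric dy_dy. Qed.

Lemma adapted_Gv_sym a p i j : D p ->
  adapted S a (Gv S i j) p = adapted S a (Gv S j i) p.
Proof.
by move=> Dp; apply: (der_ext (der_adapted a) Dp) => r; exact: Gv_sym.
Qed.

Lemma dy_Gv_sym k p i j : D p -> dy_ k (Gv S i j) p = dy_ k (Gv S j i) p.
Proof. exact: (adapted_Gv_sym (Ay k)). Qed.

Lemma dy_Gv_swap p m i j : D p -> dy_ m (Gv S i j) p = dy_ i (Gv S m j) p.
Proof. exact: (dy_vertical_swap openD der_dy dy_dy sL). Qed.

Lemma adapted_x_hup k p : adapted S (Ax k) (hup S) p = 0.
Proof.
rewrite /= (dx_tc k (fun t => (h11 S t)^-1)) sub0r big1 ?oppr0// => j _.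
by rewrite (dy_tc j (fun t => (h11 S t)^-1)) mulr0.
Qed.

Lemma adapted_y_hup k p : adapted S (Ay k) (hup S) p = 0.
Proof. exact: (dy_tc k (fun t => (h11 S t)^-1)). Qed.

Lemma adapted_x_H1 k p : adapted S (Ax k) (H1 S) p = 0.
Proof.
pose H (t : R) := (h11 S t)^-1 / 2 * derive1 (h11 S) t.
rewrite /= (dx_tc k H) sub0r big1 ?oppr0// => j _.
by rewrite (dy_tc j H) mulr0.
Qed.

Lemma adapted_y_H1 k p : adapted S (Ay k) (H1 S) p = 0.
Proof. exact: (dy_tc k (fun t => (h11 S t)^-1 / 2 * derive1 (h11 S) t)). Qed.

Lemma adapted_t_hup p : D p -> adapted S At (hup S) p = - 2 * H1 S p * hup S p.
Proof.
move=> Dp; have h0 := h_neq0 Dp.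
rewrite /= big1 ?subr0 => [|j _]; last first.
  by rewrite (dy_tc j (fun t => (h11 S t)^-1)) mulr0.
(* Leibniz rule for the constant product h^11 h_11 = 1, with dh_11/dt = 2 H h_11. *)
have := derM der_dt Dp smooth_hup sh; rewrite dt_tc.
rewrite (_ : dt_ _ p = 0); last first.
  rewrite -(der_cst der_dt 1 Dp); apply: (der_ext der_dt Dp) => r Dr.
  by rewrite /hup mulVf ?h_neq0.
move=> /esym/eqP; rewrite addr_eq0 => /eqP E.
by apply: (mulIf h0); rewrite E /H1 /hup; field.
Qed.

Lemma adapted_gij a i j p : D p -> adapted S a (Gv S i j) p =
  adapted S a (hup S) p * gij S i j p + hup S p * adapted S a (gij S i j) p.
Proof.
move=> Dp; rewrite -(derM (der_adapted a) Dp smooth_hup (smooth_gij i j)).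
by apply: (der_ext (der_adapted a) Dp) => r Dr; rewrite GvE.
Qed.

Lemma adapted_x_Gv k i j p : D p ->
  adapted S (Ax k) (Gv S i j) p = hup S p * adapted S (Ax k) (gij S i j) p.
Proof.
by move=> Dp; rewrite (adapted_gij _ _ _ Dp) adapted_x_hup mul0r add0r.
Qed.

Lemma adapted_y_Gv k i j p : D p ->
  dy_ k (Gv S i j) p = hup S p * dy_ k (gij S i j) p.
Proof.
move=> Dp; have := adapted_gij (Ay k) i j Dp.
by rewrite adapted_y_hup mul0r add0r.
Qed.

Lemma adapted_t_Gv i j p : D p -> adapted S At (Gv S i j) p =
  hup S p * adapted S At (gij S i j) p - 2 * H1 S p * Gv S i j p.
Proof.
by move=> Dp; rewrite (adapted_gij _ _ _ Dp) (adapted_t_hup Dp) (GvE Dp); ring.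
Qed.

(** Vertical derivatives pass over h^11, and total symmetry of dG/dy cancels the last two of the
    three Christoffel terms. *)
Lemma lower_C p l i m : D p ->
  \sum_r Gv S l r p * Cc S r i m p = 2^-1 * dy_ m (Gv S i l) p.
Proof.
move=> Dp; rewrite (lower _ _ Dp).
have -> : hup S p / 2 * (dy_ m (gij S i l) p + dy_ i (gij S m l) p
    - dy_ l (gij S i m) p) = 2^-1 * (dy_ m (Gv S i l) p + dy_ i (Gv S m l) p
    - dy_ l (Gv S i m) p) by rewrite !(adapted_y_Gv _ _ _ Dp); ring.
have E (a b c : R) : c = b -> 2^-1 * (a + b - c) = 2^-1 * a.
  by move=> ->; rewrite addrK.
exact: E (etrans (dy_Gv_swap l i m Dp) (dy_Gv_sym i l m Dp)).
Qed.

Lemma lower_L p l i m : D p ->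
  \sum_r Gv S l r p * Lc S r i m p =
  2^-1 * (adapted S (Ax m) (Gv S i l) p + adapted S (Ax i) (Gv S m l) p
          - adapted S (Ax l) (Gv S i m) p).
Proof. by move=> Dp; rewrite (lower _ _ Dp) !(adapted_x_Gv _ _ _ Dp); ring. Qed.

Lemma lower_G p l i : D p ->
  \sum_r Gv S l r p * Gc S r i p =
  2^-1 * adapted S At (Gv S l i) p + H1 S p * Gv S l i p.
Proof. by move=> Dp; rewrite (lower _ _ Dp) (adapted_t_Gv _ _ Dp); field. Qed.

Lemma gij_sym p i j : D p -> gij S i j p = gij S j i p.
Proof.
move=> Dp; have E := congr1 ( *%R (h11 S (tc p))) (Gv_sym i j Dp).
exact: etrans (gijE i j Dp) (etrans E (esym (gijE j i Dp))).
Qed.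

Lemma adapted_gij_sym a p i j : D p ->
  adapted S a (gij S i j) p = adapted S a (gij S j i) p.
Proof.
by move=> Dp; apply: (der_ext (der_adapted a) Dp) => r; exact: gij_sym.
Qed.

Lemma dy_gij_sym k p i j : D p -> dy_ k (gij S i j) p = dy_ k (gij S j i) p.
Proof. exact: (adapted_gij_sym (Ay k)). Qed.

Let swap_args (a b c d e : R) : c = d -> e * (a + b - c) = e * (b + a - d).
Proof. by move=> ->; rewrite (addrC a). Qed.

Lemma Lc_sym p r i j : D p -> Lc S r i j p = Lc S r j i p.
Proof.
move=> Dp; apply: eq_bigr => m _.
exact: swap_args (adapted_gij_sym (Ax m) i j Dp).
Qed.

Lemma Cc_sym p r i j : D p -> Cc S r i j p = Cc S r j i p.
Proof.
move=> Dp; apply: eq_bigr => m _.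
exact: swap_args (dy_gij_sym m i j Dp).
Qed.

Lemma adapted_t_yc i p : adapted S At (yc i) p = H1 S p * yc i p.
Proof.
rewrite /= dt_yc sub0r (bigD1 i)//= dy_yc eqxx mulr1 big1 => [|j ji].
  by rewrite addr0 /Mc mulNr opprK.
by rewrite dy_yc eq_sym (negPf ji) mulr0.
Qed.

Lemma adapted_x_yc k i p : adapted S (Ax k) (yc i) p = - Nc S i k p.
Proof.
rewrite /= dx_yc sub0r (bigD1 i)//= dy_yc eqxx mulr1 big1 ?addr0// => j ji.
by rewrite dy_yc eq_sym (negPf ji) mulr0.
Qed.

(** * Deflections and covariant derivatives in components *)

Lemma sum_subr_delta (c f : 'I_n -> R) (x : R) i :
  \sum_m (c m - (m == i)%:R * x) * f m = \sum_m c m * f m - x * f i.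
Proof.
rewrite -(sum_delta (fun m => x * f m) i) -sumrB.
by apply: eq_bigr => m _; ring.
Qed.

Lemma asum_x (F : aidx n -> R) : F At = 0 -> (forall i, F (Ay i) = 0) ->
  asum F = \sum_i F (Ax i).
Proof. by move=> F0 Fy; rewrite /asum F0 add0r [X in _ + X]big1 ?addr0. Qed.

Lemma asum_y (F : aidx n -> R) : F At = 0 -> (forall i, F (Ax i) = 0) ->
  asum F = \sum_i F (Ay i).
Proof. by move=> F0 Fx; rewrite /asum F0 add0r [X in X + _]big1 ?add0r. Qed.

Lemma asum0 (F : aidx n -> R) : (forall a, F a = 0) -> asum F = 0.
Proof. by move=> F0; rewrite asum_x// big1. Qed.

(** The H in X_t y^i cancels the H in the vertical connection coefficient. *)
Lemma defl_tE i p : defl_t S i p = \sum_m Gc S i m p * yc m p.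
Proof.
rewrite /defl_t /nabla10 [adapted _ _ _ _]adapted_t_yc asum_y /= ?mul0r//.
under eq_bigr => m _ do rewrite eq_sym.
by rewrite (sum_subr_delta (Gc S i ^~ p) (fun m => yc m p)) addrC subrK.
Qed.

Lemma defl_xE i k p :
  defl_x S i k p = - Nc S i k p + \sum_m Lc S i m k p * yc m p.
Proof.
rewrite /defl_x /nabla10 [adapted _ _ _ _]adapted_x_yc asum_y /= ?mul0r//.
Qed.

Lemma defl_yE i k p :
  defl_y S i k p = (i == k)%:R + \sum_m Cc S i m k p * yc m p.
Proof.
rewrite /defl_y /nabla10 [adapted _ _ _ _]dy_yc asum_y /= ?mul0r//.
Qed.

Let Xx (k : 'I_n) := adapted S (Ax k).
Let Xy (k : 'I_n) := adapted S (Ay k).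

Lemma defl_t_lE : defl_t_l S = Dt (Gv S) (Gc S) (@yc R n).
Proof.
apply/funext => i; apply/funext => p.
by apply: eq_bigr => r _; rewrite defl_tE.
Qed.

Lemma defl_x_lE : defl_x_l S = Dx (Gv S) (Nc S) (@yc R n) (Lc S).
Proof.
apply/funext => i; apply/funext => k; apply/funext => p.
by apply: eq_bigr => r _; rewrite defl_xE.
Qed.

Lemma defl_y_lE : defl_y_l S = Dy (Gv S) (@yc R n) (Cc S).
Proof.
apply/funext => i; apply/funext => k; apply/funext => p.
by apply: eq_bigr => r _; rewrite defl_yE.
Qed.

Lemma FemE : Fem S = em (Gv S) (Nc S) (@yc R n) (Lc S).
Proof. by rewrite /Fem defl_x_lE. Qed.

Lemma Fem_xE : Fem_x S = em_x Xx (Gv S) (Nc S) (@yc R n) (Lc S).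
Proof.
apply/funext => i; apply/funext => j; apply/funext => k; apply/funext => p.
rewrite /em_x -FemE /Fem_x /nabla02.
by rewrite asum_y ?asum_x //= ?mul0r.
Qed.

Lemma Fem_yE : Fem_y S = em_y Xy (Gv S) (Nc S) (@yc R n) (Lc S) (Cc S).
Proof.
apply/funext => i; apply/funext => j; apply/funext => k; apply/funext => p.
rewrite /em_y -FemE /Fem_y /nabla02.
by rewrite asum_y ?asum_x //= ?mul0r.
Qed.

Lemma Fem_tE i k p : Fem_t S i k p =
  em_t (adapted S At) (Gv S) (Gc S) (Nc S) (@yc R n) (H1 S) (Lc S) i k p.
Proof.
rewrite /em_t -FemE /Fem_t /nabla02 -[Fem_tensor S (Ay i) (Ax k)]/(Fem S i k).
move: (adapted S At (Fem S i k) p) => X; rewrite asum_y ?asum_x //= ?mul0r//.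
have E (a b c d : R) : a = b - c -> X - a - d = X + c - b - d.
  by move=> ->; rewrite opprB addrA.
exact: E (sum_subr_delta (fun m => Gc S m i p) (fun m => Fem S m k p) _ i).
Qed.

Lemma defl_t_l_xE i k p : defl_t_l_x S i k p =
  Dtx Xx (Gv S) (Gc S) (@yc R n) (Lc S) i k p.
Proof.
rewrite /Dtx -defl_t_lE /defl_t_l_x /nabla02 asum_y /= ?mul0r//.
by rewrite asum0 ?subr0// => -[|m|m]; rewrite mul0r.
Qed.

Lemma smooth_Gc i j : smooth D (Gc S i j).
Proof.
apply: (smooth_sum openD) => m _; apply: (smoothM openD).
  by apply: (smoothM openD); [exact: smooth_gup|exact: smooth_cst].
exact: (der_smooth (der_adapted At) (smooth_gij m j)).
Qed.

Lemma Ttor_xE m i k p : D p -> Ttor_x S m i k p = Ttx Xx (Gc S) (Lc S) m i k p.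
Proof.
move=> Dp; rewrite /Ttx /Ttor_x /nabla12.
rewrite -[Ttor_tensor S (Ax m) At (Ax i)]/(fun q => - Gc S m i q).
rewrite (derN openD (der_adapted (Ax k)) Dp (smooth_Gc m i)) -/(Xx k).
move: (Xx k (Gc S m i) p) => X; rewrite asum_x /= ?mulr0//.
(* The lower time index of T contributes nothing, as the derivative of d/dt along X_k vanishes. *)
rewrite asum0; last by move=> -[|r|r]; rewrite mul0r.
rewrite subr0 asum_x /= ?mulr0 ?mul0r// -!sumrN.
congr (_ + _ + _); apply: eq_bigr => r _; first by rewrite /Ttor mulrN.
by rewrite /Ttor mulrN opprK.
Qed.

Theorem local_Maxwell p : D p ->
  [/\ (forall i k : 'I_n,
         Fem_t S i k p =
         2^-1 * alternate (fun i k : 'I_n =>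
           defl_t_l_x S i k p
           + \sum_(m < n) defl_x_l S i m p * Ttor S m k p
           + \sum_(m < n) defl_y_l S i m p * Rt S m k p
           - \sum_(q < n) (Ttor_x S q i k p
                           + \sum_(m < n) Cc S q k m p * Rt S m i p)
                          * ylow S q p) i k),
      (forall i j k : 'I_n,
         cyclic_sum (fun i j k : 'I_n => Fem_x S i j k p) i j k =
         - cyclic_sum (fun i j k : 'I_n =>
             \sum_(l < n) \sum_(m < n)
               Clow S i l m p * Rx S m j k p * yc l p) i j k),
      (forall i j k : 'I_n,
         cyclic_sum (fun i j k : 'I_n => Fem_y S i j k p) i j k = 0) &
      (forall i l m : 'I_n,
         Clow S i l m p = 4^-1 * dy_ i (dy_ l (dy_ m (Lag S))) p)].
Proof.
(* K consists of second vertical derivatives of the spray, whence its symmetry in i and j. *)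
move=> Dp; pose K m i j := dy_ i (Nc S m j).
have sy i := smooth_yc i openD.
have dX k : derivation D (Xx k) := der_adapted (Ax k).
have dY k : derivation D (Xy k) := der_adapted (Ay k).
have dT := der_adapted At.
have Ksym q : D q -> forall m i j, K m i j q = K m j i q.
  by move=> Dq m i j; exact: dy_dy Dq (smooth_spray m).
have Bianchi q : D q -> forall i j k, \sum_m Gv S i m q * Rx S m j k q
    + \sum_m Gv S j m q * Rx S m k i q + \sum_m Gv S k m q * Rx S m i j q = 0.
  move=> Dq i j k.
  apply: (@cyclic_curvature R _ D n (@dt_ R n) (@dx_ R n) (@dy_ R n) (Lag S)
    (H1 S) (@yc R n) (spray S) openD der_dt der_dx der_dy dt_dy dx_dx dx_dy
    dy_dy sL smooth_H1 sy smooth_spray _ _ _ q i j k Dq).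
  - by move=> r Dr l; exact: adapted_y_H1.
  - by move=> r Dr l m; exact: dy_yc.
  - by move=> r Dr l; exact: lower_spray.
have Gs q (Dq : D q) i j := Gv_sym i j Dq.
have lL q (Dq : D q) l i m := lower_L l i m Dq.
have lC q (Dq : D q) l i m := lower_C l i m Dq.
have lG q (Dq : D q) l i := lower_G l i Dq.
have Ls q (Dq : D q) r i j := Lc_sym r i j Dq.
have Cs q (Dq : D q) r i j := Cc_sym r i j Dq.
have ty q (Dq : D q) i := adapted_t_yc i q.
have xy q (Dq : D q) k i := adapted_x_yc k i q.
have yy q (Dq : D q) k i := dy_yc k i q.
have xH q (Dq : D q) k := adapted_x_H1 k q.
have xx f q (Dq : D q) (sf : smooth D f) i j := adapted_x_x i j Dq sf.
have tx f q (Dq : D q) (sf : smooth D f) j := adapted_t_x j Dq sf.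
have yx f q (Dq : D q) (sf : smooth D f) i j := dy_adapted_x i j Dq sf.
have swap q (Dq : D q) m i j := dy_Gv_swap m i j Dq.
have ClowE i l m : Clow S i l m p = 2^-1 * dy_ m (Gv S i l) p := lC p Dp l i m.
split.
- move=> i k; rewrite Fem_tE.
  rewrite (em_t_Maxwell (Xy := Xy) (Cc := Cc S) (Rt := Rt S) openD dT dX dY
    smooth_Gv sy smooth_Gc smooth_H1 Gs lL lC lG Ls ty xy yy xH tx i k Dp).
  rewrite /alternate -defl_x_lE -defl_y_lE -!defl_t_l_xE.
  have TE a b :
      \sum_q (Ttor_x S q a b p + \sum_m Cc S q b m p * Rt S m a p) * ylow S q p
    = \sum_q (Ttx Xx (Gc S) (Lc S) q a b p
              + \sum_m Cc S q b m p * Rt S m a p) * ylow S q p.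
    by apply: eq_bigr => r _; rewrite (Ttor_xE _ _ _ Dp).
  have E (u v s s' t t' : R) : s = s' -> t = t' ->
    2^-1 * ((u - s') - (v - t')) = 2^-1 * ((u - s) - (v - t)) by move=> -> ->.
  exact: E (TE i k) (TE k i).
- move=> i j k; rewrite /cyclic_sum Fem_xE.
  have CE a b c : \sum_l \sum_m 2^-1 * Xy m (Gv S a l) p * Rx S m b c p * yc l p
      = \sum_l \sum_m Clow S a l m p * Rx S m b c p * yc l p.
    by apply: eq_bigr => l _; apply: eq_bigr => m _; rewrite ClowE.
  have E (u v w u' v' w' : R) : u = u' -> v = v' -> w = w' ->
    - (u + v + w) = - (u' + v' + w') by move=> -> -> ->.
  exact: etrans (cyclic_em_x openD dX dY smooth_Gv sy Gs lL Ls xy yy xx Bianchi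
    i j k Dp) (E _ _ _ _ _ _ (CE i j k) (CE j k i) (CE k i j)).
- move=> i j k; rewrite /cyclic_sum Fem_yE.
  exact: (cyclic_em_y openD dX dY smooth_Gv sy Gs swap lL Ls Cs xy yy yx Ksym
    i j k Dp).
- move=> i l m; rewrite ClowE.
  (* Transpositions bring the derivatives into the order i, l, m. The factor 1/4 is the 1/2 of
     [ClowE] times the 1/2 in G. *)
  have E := etrans (dy_Gv_sym m i l Dp) (etrans (swap p Dp m l i) (etrans
    (dy_Gv_sym l m i Dp) (swap p Dp l i m))).
  rewrite E (derZ openD (der_dy i) _ Dp (der_smooth (der_dy l) (smooth_dL m))).
  by field.
Qed.

End LocalGeometry.

(** * Reduction of the global statement to one pair of charts *)

Unset Implicit Arguments.

Theorem theorem3p2p1 (R : realType) (n : nat) (M : topologicalType)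
    (atlas : set (chart M 'rV[R]_n)) (hM : smooth_manifold atlas)
    (h : chart R R -> R -> R) (hh : semi_Riemannian_metric h)
    (L : on_jet R n M R) (g : on_jet R n M 'M[R]_n)
    (hL : rheonomic_Lagrange_space atlas h L g)
    (s : chart R R) (hs : time_chart s)
    (a : chart M 'rV[R]_n) (ha : atlas a)
    (p : jet R n) (hp : jet_range s a p) :
  let S := local_expression h L g s a in
  [/\ (forall i k : 'I_n,
         Fem_t S i k p =
         2^-1 * alternate (fun i k : 'I_n =>
           defl_t_l_x S i k p
           + \sum_(m < n) defl_x_l S i m p * Ttor S m k p
           + \sum_(m < n) defl_y_l S i m p * Rt S m k p
           - \sum_(q < n) (Ttor_x S q i k p
                           + \sum_(m < n) Cc S q k m p * Rt S m i p)
                          * ylow S q p) i k),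
      (forall i j k : 'I_n,
         cyclic_sum (fun i j k : 'I_n => Fem_x S i j k p) i j k =
         - cyclic_sum (fun i j k : 'I_n =>
             \sum_(l < n) \sum_(m < n)
               Clow S i l m p * Rx S m j k p * yc l p) i j k),
      (forall i j k : 'I_n,
         cyclic_sum (fun i j k : 'I_n => Fem_y S i j k p) i j k = 0) &
      (forall i l m : 'I_n,
         Clow S i l m p = 4^-1 * dy_ i (dy_ l (dy_ m (Lag S))) p)].
Proof.
move=> S; have [[smL _] [reg _ rk _]] := hL; have [hmet _] := hh.
have [sh h0] := hmet s hs.
have [_ ors _ _ _] : is_chart s by case: hs.
have [_ ora _ _ _] : is_chart a by have [_ _ + _ _] := hM; apply.
have openD : open (jet_range s a).
  apply: openI; apply: open_comp => // q _.
  - by apply: (continuous_comp (f := fst)); exact: cvg_fst.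
  - apply: (continuous_comp (f := fst)); first exact: cvg_fst.
    exact: cvg_snd.
apply: (local_Maxwell openD _ _ _ _ _ hp).
- exact: smooth_on_smooth (smL s a hs ha).
- apply: (smooth_tc (U := range_of s)) => //; first by move=> q [].
  exact: smooth_on_smooth sh.
- by move=> q [Dq _]; exact: h0.
- by move=> q Dq i j; exact: reg.
- by move=> q Dq; rewrite -row_free_unit /row_free (rk s a hs ha q Dq).
Qed.
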